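(* Consider a sequence of $T$ $n$-player normal-form games with action sets $\mathcal A_k$, $|\mathcal A_k|=d_k$, each repeated for $m$ iterations. Let $\alpha:=(mT)^{-1/3}$ and, for $x_k\in\Delta(\mathcal A_k)$, let $\tilde x_k:=(1-\alpha)x_k+\alpha\frac1{d_k}\mathbf 1_{d_k}$. Suppose each player $k$ employs the no-swap-regret algorithm of Blum and Mansour instantiated with optimistic mirror descent (OMD) under the logarithmic regularizer $\mathcal R_k:x_k\mapsto-\sum_{a\in\mathcal A_k}\log x_k[a]$, with a sufficiently small learning rate $\eta>0$, and with initialization $x_a^{(t,0)}=\frac1{t-1}\sum_{s<t}\tilde{\mathring x}_a^{(s)}$ for all $a\in\mathcal A_k$ and $t\ge2$. Then, for every player $k\in\{1,\dots,n\}$, $$\frac1T\sum_{t=1}^T\mathrm{SwapReg}_k^{(t,m)}\le\frac1\eta\sum_{k'=1}^n\sum_{a\in\mathcal A_{k'}}\tilde V_{k',a}^2+\frac{m^{2/3}}{T^{1/3}}\left(2n+\sum_{k'=1}^n\frac{8d_{k'}^3(1+\log T)}{\eta}\right),$$ where $\tilde V_{k,a}^2:=\frac1T\sum_{t=1}^T\mathcal B_{\mathcal R_k}(\tilde{\mathring x}_a^{(t)}\,\|\,\bar x_a)$ with $\bar x_a=\frac1T\sum_{t=1}^T\tilde{\mathring x}_a^{(t)}$ is the task similarity for the individual regret minimizer of player $k$ associated with action $a\in\mathcal A_k$.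
   Context: In game $t$ at iteration $i$ player $k$ plays $x_k^{(t,i)}\in\Delta(\mathcal A_k)$ and observes $u_k^{(t,i)}=u_k^{(t)}(x_{-k}^{(t,i)})\in\mathbb R^{d_k}$, the vector of expected utilities of its actions, $\|u_k^{(t,i)}\|_\infty\le1$. Swap regret: $\mathrm{SwapReg}_k^{(t,m)}:=\max_{\phi}\sum_{i=1}^m\langle\phi(x_k^{(t,i)})-x_k^{(t,i)},u_k^{(t,i)}\rangle$, the maximum over all linear maps $\phi:\Delta(\mathcal A_k)\to\Delta(\mathcal A_k)$. Blum–Mansour algorithm: player $k$ maintains one regret minimizer over $\Delta(\mathcal A_k)$ for each action $a\in\mathcal A_k$, which outputs $x_a^{(t,i)}\in\Delta(\mathcal A_k)$. The played strategy $x_k^{(t,i)}$ is any stationary distribution of the Markov chain on $\mathcal A_k$ whose transition probabilities out of state $a$ are $x_a^{(t,i)}$. The regret minimizer of action $a$ is then fed the utility vector $u_a^{(t,i)}:=x_k^{(t,i)}[a]\,u_k^{(t,i)}$. $\mathring x_a^{(t)}\in\arg\max_{x\in\Delta(\mathcal A_k)}\sum_{i=1}^m\langle x,u_a^{(t,i)}\rangle$ is the optimum in hindsight of that minimizer in game $t$ (ties broken by a fixed rule). Each regret minimizer is OMD: with $\hat x_a^{(t,0)}=x_a^{(t,0)}$, for $i\ge1$, $x_a^{(t,i)}=\arg\max_{x}\{\langle x,u_a^{(t,i-1)}\rangle-\frac1\eta\mathcal B_{\mathcal R_k}(x\|\hat x_a^{(t,i-1)})\}$, $\hat x_a^{(t,i)}=\arg\max_{x}\{\langle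 x,u_a^{(t,i)}\rangle-\frac1\eta\mathcal B_{\mathcal R_k}(x\|\hat x_a^{(t,i-1)})\}$, where $u_a^{(t,0)}$ is computed from the initial strategies (index $i=0$) in game $t$. $\mathcal B_{\mathcal R}(x\|x')=\mathcal R(x)-\mathcal R(x')-\langle\nabla\mathcal R(x'),x-x'\rangle$ is the Bregman divergence. In game 1 each minimizer starts at the minimizer of $\mathcal R_k$ (uniform distribution). ''Sufficiently small learning rate'' means: there exists $\eta_0>0$, depending only on the parameters of the games (such as $n$ and the $d_k$), such that the statement holds for $0<\eta\le\eta_0$. *)

(* Defs.v *)
From HB Require Import structures.
From mathcomp Require Export all_boot all_order all_algebra.
From mathcomp Require Export all_classical all_reals all_analysis.

Set Implicit Arguments.
Unset Strict Implicit.
Unset Printing Implicit Defensive.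

Export Order.TTheory GRing.Theory Num.Theory.
Export numFieldNormedType.Exports.

Local Open Scope classical_set_scope.
Local Open Scope ring_scope.

Section Simplex.
Variables (R : realType) (d : nat).
Implicit Types (x y u : 'rV[R]_d).

Definition dot x y : R := \sum_(a < d) x 0 a * y 0 a.

Definition simplex : set 'rV[R]_d :=
  [set x | (forall a, 0 <= x 0 a) /\ \sum_(a < d) x 0 a = 1].

Definition simplex_interior : set 'rV[R]_d :=
  [set x | simplex x /\ forall a, 0 < x 0 a].

Definition uniform : 'rV[R]_d := const_mx (d%:R^-1).

Definition mix_uniform (alpha : R) x : 'rV[R]_d :=
  (1 - alpha) *: x + alpha *: uniform.

Definition argmax (S : set 'rV[R]_d) (f : 'rV[R]_d -> R) : set 'rV[R]_d :=
  [set x | S x /\ forall y, S y -> f y <= f x].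

Definition gradient (f : 'rV[R]_d -> R) x : 'rV[R]_d :=
  \row_(a < d) 'D_(delta_mx 0 a) f x.

Definition bregman (f : 'rV[R]_d -> R) x y : R :=
  f x - f y - dot (gradient f y) (x - y).

(* [ln] is 0 on nonpositive arguments, whereas the regularizer is +oo on the
   boundary of the simplex; it is therefore only used on [simplex_interior]. *)
Definition log_barrier x : R := - \sum_(a < d) ln (x 0 a).

(* The maximization ranges over the domain of the regularizer in the simplex:
   boundary points have objective value -oo. *)
Definition omd_argmax (eta : R) u y : set 'rV[R]_d :=
  argmax simplex_interior
    (fun x => dot x u - eta^-1 * bregman log_barrier x y).

(* A linear map simplex -> simplex is given by a linear map of R^d that
   preserves the simplex. The supremum is a maximum since these maps form a
   nonempty compact set (nonempty and bounded value set as soon as [0 < d]). *)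
Definition swap_regret (m : nat) (x u : nat -> 'rV[R]_d) : R :=
  sup [set r | exists phi : {linear 'rV[R]_d -> 'rV[R]_d},
         (forall y, simplex y -> simplex (phi y)) /\
         r = \sum_(1 <= i < m.+1) dot (phi (x i) - x i) (u i)].

(* Row [a] of [P] is the transition distribution out of state [a]. *)
Definition stationary (P : 'M[R]_d) x : Prop := simplex x /\ x *m P = x.

End Simplex.

Section Game.
Variables (R : realType) (n : nat) (d : 'I_n -> nat).

Definition action_profile := {dffun forall k : 'I_n, 'I_(d k)}.

Definition mixed_profile := forall k : 'I_n, 'rV[R]_(d k).

Definition game := forall k : 'I_n, action_profile -> R.

(* The vector u_k(x_{-k}): entry [a] is the expected payoff of player [k] for
   action [a] when every other player [j] draws an action from [x j]. *)
Definition expected_utility (G : game) (x : mixed_profile) (k : 'I_n) :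
    'rV[R]_(d k) :=
  \row_(a < d k) \sum_(b : action_profile | b k == a)
     G k b * \prod_(j < n | j != k) x j 0 (b j).

(* The norm on row vectors is the sup norm. *)
Definition normalized_game (G : game) : Prop :=
  forall x : mixed_profile, (forall k, simplex (x k)) ->
  forall k, `|expected_utility G x k| <= 1.

(* Games are numbered [t = 1, ..., T] and iterations [i = 0, ..., m] (the index
   0 being the initialization); values outside these ranges are irrelevant. *)
Record trajectory := Trajectory {
  played : nat -> nat -> mixed_profile;
  minimizer : nat -> nat -> forall k : 'I_n, 'I_(d k) -> 'rV[R]_(d k);
  minimizer_hat : nat -> nat -> forall k : 'I_n, 'I_(d k) -> 'rV[R]_(d k)
}.

(* A tie-breaking rule for each player and action: it selects a point from
   every nonempty set of candidates. *)
Definition tie_rule :=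
  forall k : 'I_n, 'I_(d k) -> set 'rV[R]_(d k) -> 'rV[R]_(d k).

Definition is_tie_rule (tie : tie_rule) : Prop :=
  forall k a (S : set 'rV[R]_(d k)), S !=set0 -> S (tie k a S).

Section Dynamics.
Variables (m T : nat) (G : nat -> game) (alpha eta : R).
Variables (tie : tie_rule) (tr : trajectory).

Definition utility (t i : nat) (k : 'I_n) : 'rV[R]_(d k) :=
  expected_utility (G t) (played tr t i) k.

Definition minimizer_utility (t i : nat) (k : 'I_n) (a : 'I_(d k)) :
    'rV[R]_(d k) :=
  played tr t i k 0 a *: utility t i k.

Definition hindsight_opt (t : nat) (k : 'I_n) (a : 'I_(d k)) : 'rV[R]_(d k) :=
  tie a (argmax (@simplex R (d k))
    (fun y => \sum_(1 <= i < m.+1) dot y (minimizer_utility t i a))).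

Definition mixed_opt (t : nat) (k : 'I_n) (a : 'I_(d k)) : 'rV[R]_(d k) :=
  mix_uniform alpha (hindsight_opt t a).

Record blum_mansour_omd : Prop := BlumMansourOMD {
  bm_stationary : forall t i k, (1 <= t <= T)%N -> (i <= m)%N ->
    stationary (\matrix_(a < d k) minimizer tr t i a) (played tr t i k);
  omd_hat0 : forall t k (a : 'I_(d k)), (1 <= t <= T)%N ->
    minimizer_hat tr t 0 a = minimizer tr t 0 a;
  omd_first_game : forall k (a : 'I_(d k)),
    minimizer tr 1 0 a = uniform R (d k);
  omd_next_game : forall t k (a : 'I_(d k)), (2 <= t <= T)%N ->
    minimizer tr t 0 a = (t.-1)%:R^-1 *: \sum_(1 <= s < t) mixed_opt s a;
  omd_step : forall t i k (a : 'I_(d k)), (1 <= t <= T)%N -> (1 <= i <= m)%N ->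
    omd_argmax eta (minimizer_utility t i.-1 a) (minimizer_hat tr t i.-1 a)
      (minimizer tr t i a);
  omd_hat_step : forall t i k (a : 'I_(d k)),
    (1 <= t <= T)%N -> (1 <= i <= m)%N ->
    omd_argmax eta (minimizer_utility t i a) (minimizer_hat tr t i.-1 a)
      (minimizer_hat tr t i a)
}.

Definition mean_opt (k : 'I_n) (a : 'I_(d k)) : 'rV[R]_(d k) :=
  T%:R^-1 *: \sum_(1 <= t < T.+1) mixed_opt t a.

(* This is the squared quantity V_{k,a}^2. *)
Definition task_similarity_sq (k : 'I_n) (a : 'I_(d k)) : R :=
  T%:R^-1 * \sum_(1 <= t < T.+1)
    bregman (@log_barrier R (d k)) (mixed_opt t a) (mean_opt a).

Definition average_swap_regret (k : 'I_n) : R :=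
  T%:R^-1 * \sum_(1 <= t < T.+1)
    swap_regret m (fun i => played tr t i k) (fun i => utility t i k).

End Dynamics.
End Game.

(* Main.v *)
Require Import Defs.
From mathcomp Require Import all_boot all_order all_algebra.
From mathcomp Require Import all_classical all_reals all_analysis.
From mathcomp Require Import ring lra.

Set Implicit Arguments.
Unset Strict Implicit.
Unset Printing Implicit Defensive.

Local Open Scope classical_set_scope.
Local Open Scope ring_scope.

(* Against interior comparators, optimistic mirror descent has regret
   at most [B(z || x_0) / eta], plus the correlation of the steps with the
   variation of the utilities, minus [1 / eta] times the Bregman movement of the
   iterates. Variation is controlled by movement: the utilities are Lipschitz in
   the played strategies, and these are stationary distributions, whose relative
   change is at most [O(d)] times the relative change of the transition
   probabilities, whatever the mixing time. The log barrier measures precisely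
   relative change, so for small [eta] the movement terms cancel after summing
   over the players, in every game separately. Since swap regret is nonnegative,
   each player is bounded by the sum. What remains is the average of
   [B(mixed_opt || x_0)]: the initialization is follow-the-leader for Bregman
   losses, whose excess over the best fixed point is [\sum_t t B(mu_t ||
   mu_(t-1)) = O(d^2 log T / alpha^2)], as coordinates are at least
   [alpha / d]. *)

(** * The divergence of [- ln] as a function of a ratio *)

Section LogDeviation.
Variable R : realType.
Implicit Types x y z c e : R.

(** At [z = x / y] this is the one-dimensional Bregman divergence of [- ln] between [x] and [y], so
    the log barrier sees only relative change. *)
Definition log_dev z : R := z - 1 - ln z.

Lemma ln_le_sub1 z : 0 < z -> ln z <= z - 1.
Proof.
move=> z0; have := @le_ln1Dx R (z - 1).
rewrite subrKC; apply; lra.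
Qed.

(* [ln z = 2 ln (sqrt z) <= 2 (sqrt z - 1)] *)
Lemma log_dev_ge_sqrt z : 0 < z -> (Num.sqrt z - 1) ^+ 2 <= log_dev z.
Proof.
move=> z0; have s0 : 0 < Num.sqrt z by rewrite sqrtr_gt0.
have zE : z = Num.sqrt z ^+ 2 by rewrite sqr_sqrtr ?ltW.
rewrite /log_dev {2 3}zE lnXn// mulr2n.
have := ln_le_sub1 s0; nra.
Qed.

Lemma log_dev_ge0 z : 0 < z -> 0 <= log_dev z.
Proof. by move=> z0; rewrite (le_trans _ (log_dev_ge_sqrt z0))// sqr_ge0. Qed.

(** Comes from [ln_le_sub1] at [z^-1], since [z - 2 + z^-1] is the right-hand side. *)
Lemma log_dev_le z : 0 < z -> log_dev z <= (z - 1) ^+ 2 / z.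
Proof.
move=> z0; have zN0 : z != 0 by rewrite gt_eqF.
have zi0 : 0 < z^-1 by rewrite invr_gt0.
have := ln_le_sub1 zi0; rewrite lnV ?posrE// /log_dev.
have -> : (z - 1) ^+ 2 / z = z - 2 + z^-1 by field.
lra.
Qed.

(** With [p] and [q] the square roots, [x - y = (p - q) * (p + q)], where [p + q] is at most 2 and
    [p - q] is controlled by [log_dev_ge_sqrt]. This is what makes the barrier strongly convex on
    the simplex. *)
Lemma log_dev_ratio_ge x y : 0 < x -> x <= 1 -> 0 < y -> y <= 1 ->
  (x - y) ^+ 2 <= 4 * log_dev (x / y).
Proof.
move=> x0 x1 y0 y1.
have xE : x = Num.sqrt x ^+ 2 by rewrite sqr_sqrtr ?ltW.
have yE : y = Num.sqrt y ^+ 2 by rewrite sqr_sqrtr ?ltW.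
have : 0 < Num.sqrt x by rewrite sqrtr_gt0.
have : 0 < Num.sqrt y by rewrite sqrtr_gt0.
have := log_dev_ge_sqrt (divr_gt0 x0 y0).
rewrite sqrtrM ?(ltW x0)// sqrtrV ?(ltW y0)//.
move: (Num.sqrt x) (Num.sqrt y) xE yE => p q xE yE h q0 p0.
apply: (le_trans _ (ler_wpM2l (ler0n R 4) h)).
have qN0 : q != 0 by rewrite gt_eqF.
have -> : p / q - 1 = (p - q) / q by field.
rewrite exprMn exprVn -yE mulrA ler_pdivlMr//.
have p1 : p <= 1 by nra.
have q1 : q <= 1 by nra.
have -> : (x - y) ^+ 2 = (p - q) ^+ 2 * (p + q) ^+ 2 by rewrite xE yE; ring.
rewrite -mulrA [4 * _]mulrC ler_wpM2l ?sqr_ge0//.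
have : (p + q) ^+ 2 <= 4 by nra.
have : 0 <= (p + q) ^+ 2 by apply: sqr_ge0.
nra.
Qed.

Lemma log_dev_ratio_le c x y : 0 < c -> c <= x -> c <= y ->
  log_dev (x / y) <= c ^- 2 * (x - y) ^+ 2.
Proof.
move=> c0 cx cy.
have x0 : 0 < x := lt_le_trans c0 cx.
have y0 : 0 < y := lt_le_trans c0 cy.
have xN0 : x != 0 by rewrite gt_eqF.
have yN0 : y != 0 by rewrite gt_eqF.
apply: (le_trans (log_dev_le (divr_gt0 x0 y0))).
have -> : (x / y - 1) ^+ 2 / (x / y) = (x * y)^-1 * (x - y) ^+ 2.
  by field; rewrite ?xN0 ?yN0.
rewrite ler_wpM2r ?sqr_ge0// lef_pV2 ?posrE ?mulr_gt0 ?exprn_gt0//.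
by rewrite expr2 ler_pM// ltW.
Qed.

(** By [log_dev_ge_sqrt] the root [s] of [x / y] lies between [1 - e] and [1 + e], so also
    [(1 - e) * s <= 1]; squaring gives both directions. *)
Lemma log_dev_ratio_close x y e : 0 < x -> 0 < y -> 0 <= e <= 1 ->
  log_dev (x / y) <= e ^+ 2 -> (1 - e) ^+ 2 * y <= x /\ (1 - e) ^+ 2 * x <= y.
Proof.
move=> x0 y0 /andP[e0 e1] h.
have z0 : 0 < x / y by apply: divr_gt0.
have yN0 : y != 0 by rewrite gt_eqF.
have s0 : 0 < Num.sqrt (x / y) by rewrite sqrtr_gt0.
have : (Num.sqrt (x / y) - 1) ^+ 2 <= e ^+ 2.
  exact: le_trans (log_dev_ge_sqrt z0) h.
have zE : x / y = Num.sqrt (x / y) ^+ 2 by rewrite sqr_sqrtr ?ltW.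
move: (Num.sqrt _) s0 zE => s s0 zE.
have xE : x = s ^+ 2 * y by rewrite -zE divfK.
rewrite -subr_ge0 subr_sqr => he.
have sl : 1 - e <= s by nra.
have su : s <= 1 + e by nra.
have e1' : 0 <= 1 - e by lra.
split; rewrite xE.
  by rewrite ler_wpM2r ?(ltW y0)// ler_sqr ?nnegrE// ltW.
rewrite mulrA -exprMn -[leRHS]mul1r ler_wpM2r ?(ltW y0)//.
have p0 : 0 <= (1 - e) * s by apply: mulr_ge0 => //; apply: ltW.
rewrite exprn_ile1//; nra.
Qed.

End LogDeviation.

(** * Bregman divergence of the log barrier *)

Section LogBarrier.
Variables (R : realType) (d : nat).
Implicit Types x y z u v : 'rV[R]_d.

Lemma dotDl x y z : dot (x + y) z = dot x z + dot y z.
Proof.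
by rewrite /dot -big_split/=; apply: eq_bigr => a _; rewrite mxE mulrDl.
Qed.

Lemma dotZl (c : R) x y : dot (c *: x) y = c * dot x y.
Proof. by rewrite /dot mulr_sumr; apply: eq_bigr => a _; rewrite mxE mulrA. Qed.

Lemma dotC x y : dot x y = dot y x.
Proof. by apply: eq_bigr => a _; rewrite mulrC. Qed.

Lemma dotBl x y z : dot (x - y) z = dot x z - dot y z.
Proof. by rewrite -scaleN1r dotDl dotZl mulN1r. Qed.

Lemma dotBr x y z : dot x (y - z) = dot x y - dot x z.
Proof. by rewrite dotC dotBl !(dotC _ x). Qed.

Lemma dotZr (c : R) x y : dot x (c *: y) = c * dot x y.
Proof. by rewrite dotC dotZl dotC. Qed.

Lemma dot_suml I (r : seq I) (P : pred I) (F : I -> 'rV[R]_d) y :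
  dot (\sum_(i <- r | P i) F i) y = \sum_(i <- r | P i) dot (F i) y.
Proof.
rewrite /dot exchange_big/=; apply: eq_bigr => a _.
by rewrite summxE mulr_suml.
Qed.

Lemma dot_sumr I (r : seq I) (P : pred I) (F : I -> 'rV[R]_d) y :
  dot y (\sum_(i <- r | P i) F i) = \sum_(i <- r | P i) dot y (F i).
Proof. by rewrite dotC dot_suml; apply: eq_bigr => i _; rewrite dotC. Qed.

Lemma gradient_log_barrier y : (forall a, 0 < y 0 a) ->
  gradient (@log_barrier R d) y = \row_a - (y 0 a)^-1.
Proof.
move=> y0; apply/rowP => a; rewrite !mxE.
(* Along the basis vector of [a] only one summand of the barrier varies; the others cancel in the
   difference quotient. *)
transitivity ('D_1 (fun s : R => - ln s) (y 0 a)); last first.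
  exact: (@derive_val _ _ _ _ _ _ _ (is_deriveN (is_derive1_ln (y0 a)))).
rewrite /derive.
apply: (congr1 (fun g => lim (g @ 0^'))).
apply/funext => s /=.
apply: (congr1 (fun w : R => s^-1 *: (w : R^o))).
have E z : log_barrier z = - ln (z 0 a) - \sum_(b < d | b != a) ln (z 0 b).
  by rewrite /log_barrier (bigD1 a)//= opprD.
rewrite !E !mxE !eqxx mulr1 [s *: 1]mulr1.
rewrite [X in _ - X - _](_ : _ = \sum_(b < d | b != a) ln (y 0 b)).
  by rewrite opprD !opprK addrACA addNr addr0.
by apply: eq_bigr => b ba; rewrite !mxE eqxx (negbTE ba) mulr0 add0r.
Qed.

Lemma bregman_log_barrier x y :
  (forall a, 0 < x 0 a) -> (forall a, 0 < y 0 a) ->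
  bregman (@log_barrier R d) x y = \sum_(a < d) log_dev (x 0 a / y 0 a).
Proof.
move=> x0 y0; rewrite /bregman gradient_log_barrier// /log_barrier /dot.
rewrite opprK -!sumrN -!big_split/=; apply: eq_bigr => a _.
have yN0 : y 0 a != 0 by rewrite gt_eqF.
by rewrite !mxE /log_dev ln_div ?posrE//; field.
Qed.

Lemma bregman_log_barrier_ge0 x y :
  (forall a, 0 < x 0 a) -> (forall a, 0 < y 0 a) ->
  0 <= bregman (@log_barrier R d) x y.
Proof.
move=> x0 y0; rewrite bregman_log_barrier//; apply: sumr_ge0 => a _.
exact/log_dev_ge0/divr_gt0.
Qed.

Lemma bregman_three_point (f : 'rV[R]_d -> R) x y z :
  bregman f z y - bregman f z x - bregman f x y =
  dot (gradient f x - gradient f y) (z - x).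
Proof. by rewrite /bregman !dotBl !dotBr; ring. Qed.

End LogBarrier.

(** * The simplex and quadratic bounds for the divergence *)

Section Simplex.
Variables (R : realType) (d : nat).
Implicit Types x y z u v : 'rV[R]_d.

Lemma simplex_le1 x a : simplex x -> x 0 a <= 1.
Proof.
move=> [x0 <-]; rewrite (bigD1 a)//= lerDl.
exact: sumr_ge0.
Qed.

Lemma simplex_dim_gt0 x : simplex x -> (0 < d)%N.
Proof.
move=> [x0]; rewrite lt0n; apply: contra_eqN => /eqP d0.
by rewrite d0 in x x0 *; rewrite big_ord0 eq_sym oner_eq0.
Qed.

Lemma simplex_l1_dist_le2 x y : simplex x -> simplex y ->
  \sum_(a < d) `|x 0 a - y 0 a| <= 2.
Proof.
move=> [x0 x1] [y0 y1].
have -> : 2 = \sum_(a < d) (x 0 a + y 0 a) :> R by rewrite big_split/= x1 y1.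
apply: ler_sum => a _; rewrite (le_trans (ler_normB _ _))//.
by rewrite !ger0_norm.
Qed.

Lemma simplex_interior_segment x z (e : R) : simplex_interior x ->
  simplex_interior z -> 0 <= e <= 1 -> simplex_interior (x + e *: (z - x)).
Proof.
move=> [[x0 x1] xp] [[z0 z1] zp] /andP[e0 e1].
have pos a : 0 < (x + e *: (z - x)) 0 a.
  rewrite !mxE; have := xp a; have := zp a; nra.
split=> //; split=> [a|]; first exact/ltW.
under eq_bigr do rewrite !mxE.
by rewrite big_split/= -mulr_sumr sumrB x1 z1 subrr mulr0 addr0.
Qed.

Lemma bregman_log_barrier_ge_sqr x y : simplex_interior x ->
  simplex_interior y ->
  \sum_(a < d) (x 0 a - y 0 a) ^+ 2 <= 4 * bregman (@log_barrier R d) x y.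
Proof.
move=> [xS xp] [yS yp]; rewrite bregman_log_barrier// mulr_sumr.
by apply: ler_sum => a _; apply: log_dev_ratio_ge => //; apply: simplex_le1.
Qed.

Lemma bregman_log_barrier_le_sqr (c : R) x y : 0 < c ->
  (forall a, c <= x 0 a) -> (forall a, c <= y 0 a) ->
  bregman (@log_barrier R d) x y <=
  c ^- 2 * \sum_(a < d) (x 0 a - y 0 a) ^+ 2.
Proof.
move=> c0 cx cy.
rewrite bregman_log_barrier => [|a|a]; last 2 first.
- exact: lt_le_trans (cx a).
- exact: lt_le_trans (cy a).
by rewrite mulr_sumr; apply: ler_sum => a _; apply: log_dev_ratio_le.
Qed.

End Simplex.

(** * Regret of optimistic mirror descent *)

Section MirrorDescent.
Variables (R : realType) (d : nat) (eta : R).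
Hypothesis eta_gt0 : 0 < eta.
Implicit Types x y z u v : 'rV[R]_d.
Local Notation B := (bregman (@log_barrier R d)).

Lemma le0_of_le_mul_small (A C : R) : 0 <= C ->
  (forall e, 0 < e <= 1 / 2 -> A <= C * e) -> A <= 0.
Proof.
move=> C0 h; rewrite leNgt; apply/negP => A0.
have D0 : 0 < 2 * (A + C) by lra.
(* If [A] were positive, this witness would be at most 1/2 and [C] times it at most [A / 2]. *)
have e0 : 0 < A / (2 * (A + C)) by apply: divr_gt0.
have := h (A / (2 * (A + C))).
have -> : C * (A / (2 * (A + C))) = A * C / (2 * (A + C)).
  by rewrite mulrA [C * A]mulrC.
rewrite e0 !ler_pdivrMr// ler_pdivlMr//= => /(_ _) h'.
have : A * (2 * (A + C)) <= A * C by apply: h'; lra.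
nra.
Qed.

(* First-order optimality of [x] towards [z], obtained by comparing [x] with
   [x + e (z - x)]: the Bregman divergence between these is [O(e^2)]. *)
Lemma omd_three_point u x y z : (forall a, 0 < y 0 a) ->
  omd_argmax eta u y x -> simplex_interior z ->
  dot (z - x) u <= eta^-1 * (B z y - B z x - B x y).
Proof.
move=> y0 [xS xmax] zS; rewrite bregman_three_point -subr_le0.
set D := dot (_ - _) (z - x).
have [[x0 x1] xp] := xS; have [[z0 z1] zp] := zS.
(* With [w = z 0 a / x 0 a], [log_dev_le] bounds the term of [B xe x] at [a] by [e ^+ 2 * (w - 1) ^+
   2 / (1 + e * (w - 1))]. The denominator is at least 1/2 when [e <= 1 / 2], hence the factor 2. *)
pose C := \sum_(a < d) 2 * (z 0 a / x 0 a - 1) ^+ 2.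
have C0 : 0 <= C by apply: sumr_ge0 => a _; rewrite mulr_ge0// sqr_ge0.
have ei0 : 0 < eta^-1 by rewrite invr_gt0.
apply: (@le0_of_le_mul_small _ (eta^-1 * C)); first by rewrite mulr_ge0// ltW.
move=> e /andP[e0 e2].
have e01 : 0 <= e <= 1 by lra.
have xeS := simplex_interior_segment xS zS e01.
have := xmax _ xeS.
set xe := x + e *: (z - x) in xeS *.
have xeB : xe - x = e *: (z - x) by rewrite /xe addrC addKr.
have Bxe : B xe y = B xe x + B x y + e * D.
  have := bregman_three_point (@log_barrier R d) x y xe.
  by rewrite xeB dotZr -/D; lra.
have dxe : dot xe u = dot x u + e * dot (z - x) u by rewrite /xe dotDl dotZl.
have Ble : B xe x <= e ^+ 2 * C.
  have [_ xep] := xeS.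
  rewrite bregman_log_barrier// mulr_sumr; apply: ler_sum => a _.
  apply: (le_trans (log_dev_le (divr_gt0 (xep a) (xp a)))).
  have xN0 : x 0 a != 0 by rewrite gt_eqF.
  have -> : xe 0 a / x 0 a = 1 + e * (z 0 a / x 0 a - 1).
    by rewrite !mxE; field.
  have : 0 < z 0 a / x 0 a by apply: divr_gt0.
  move: (z 0 a / x 0 a) => w w0.
  have p0 : 0 < 1 + e * (w - 1) by nra.
  rewrite ler_pdivrMr// addrAC subrr add0r exprMn.
  have -> : e ^+ 2 * (2 * (w - 1) ^+ 2) * (1 + e * (w - 1)) =
    e ^+ 2 * (w - 1) ^+ 2 * (2 * (1 + e * (w - 1))) by ring.
  have q0 : 0 <= e ^+ 2 * (w - 1) ^+ 2 by rewrite mulr_ge0 ?sqr_ge0.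
  by apply: ler_peMr => //; nra.
rewrite Bxe dxe => h.
have h1 : e * (dot (z - x) u - eta^-1 * D) <= eta^-1 * B xe x.
  by move: h; rewrite !mulrDr; lra.
have h2 : eta^-1 * B xe x <= eta^-1 * (e ^+ 2 * C) by rewrite ler_wpM2l// ltW.
rewrite -(ler_pM2l e0) (le_trans h1)// (le_trans h2)//.
by rewrite le_eqVlt; apply/orP; left; apply/eqP; ring.
Qed.

(** One three-point inequality compares [xh i] with [z], a second one compares [x i] with [xh i]. In
    their sum the divergences from [z] telescope, and the movement through [x i] survives with a
    negative sign. *)
Lemma omd_regret_rvu (m : nat) (u x xh : nat -> 'rV[R]_d) z :
  simplex_interior z -> simplex_interior (xh 0%N) ->
  (forall i, (1 <= i <= m)%N -> omd_argmax eta (u i.-1) (xh i.-1) (x i)) ->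
  (forall i, (1 <= i <= m)%N -> omd_argmax eta (u i) (xh i.-1) (xh i)) ->
  \sum_(1 <= i < m.+1) dot (z - x i) (u i) <=
  eta^-1 * B z (xh 0%N) +
  \sum_(1 <= i < m.+1) (dot (xh i - x i) (u i - u i.-1)
    - eta^-1 * (B (x i) (xh i.-1) + B (xh i) (x i))).
Proof.
move=> zS xh0S hx hxh.
have xhS i : (i <= m)%N -> simplex_interior (xh i).
  by case: i => // i im; have [] := hxh i.+1 im.
(* The nonnegative term [B z (xh m)] is kept for the induction, where it telescopes. *)
suff: \sum_(1 <= i < m.+1) dot (z - x i) (u i) <=
  eta^-1 * (B z (xh 0%N) - B z (xh m)) +
  \sum_(1 <= i < m.+1) (dot (xh i - x i) (u i - u i.-1)
    - eta^-1 * (B (x i) (xh i.-1) + B (xh i) (x i))).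
  move=> /le_trans; apply; rewrite lerD2r ler_pM2l ?invr_gt0//.
  rewrite lerBlDr lerDl bregman_log_barrier_ge0//; first by case: zS.
  by case: (xhS m (leqnn m)).
elim: m hx hxh xhS => [_ _ _|m IH hx hxh xhS].
  by rewrite !big_geq// addr0 subrr mulr0.
rewrite !(@big_nat_recr _ _ _ m.+1)//=.
have wd i : (1 <= i <= m)%N -> (1 <= i <= m.+1)%N by case/andP=> -> /leqW ->.
have {}IH := IH (fun i im => hx i (wd i im)) (fun i im => hxh i (wd i im))
  (fun i im => xhS i (leqW im)).
have mm : (1 <= m.+1 <= m.+1)%N by rewrite /= leqnn.
have [_ xhp] := xhS m (leqnSn m).
have h1 := omd_three_point xhp (hxh _ mm) zS.
have h2 := omd_three_point xhp (hx _ mm) (xhS _ (leqnn _)).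
rewrite /= in h1 h2.
(* The first term belongs to the step with the true utility, the second to the step with the
   prediction [u m]; the third is the prediction error. *)
have E : dot (z - x m.+1) (u m.+1) = dot (z - xh m.+1) (u m.+1)
   + dot (xh m.+1 - x m.+1) (u m)
   + dot (xh m.+1 - x m.+1) (u m.+1 - u m).
  by rewrite !dotBl !dotBr; ring.
rewrite E; rewrite !(mulrBr, mulrDr) in IH h1 h2 *; lra.
Qed.

End MirrorDescent.

(** * Stationary distributions under multiplicative perturbation *)

Section MarkovStability.
Variables (R : realType) (d : nat).
Implicit Types (p q x : 'rV[R]_d) (P Q : 'M[R]_d) (S : {set 'I_d}).

(** All transitions have positive probability, as holds for iterates of a barrier method; stationary
    distributions then have full support. *)
Definition stochastic P : Prop := forall a, simplex_interior (row a P).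

Lemma stochastic_gt0 P a b : stochastic P -> 0 < P a b.
Proof. by move=> /(_ a) [_ /(_ b)]; rewrite mxE. Qed.

Lemma stochastic_sum P a : stochastic P -> \sum_(b < d) P a b = 1.
Proof. by move=> /(_ a) [[_ <-] _]; apply: eq_bigr => b _; rewrite mxE. Qed.

Lemma stationaryE P p b : stationary P p -> p 0 b = \sum_a p 0 a * P a b.
Proof. by move=> [_] {1}<-; rewrite mxE. Qed.

Lemma stationary_gt0 P p b : stochastic P -> stationary P p -> 0 < p 0 b.
Proof.
move=> PS pP; have [[p0 p1] _] := pP.
have : 0 < \sum_a p 0 a by rewrite p1.
rewrite lt0r psumr_neq0// => /andP[/hasP[a _ /= pa] _].
rewrite (stationaryE b pP) (bigD1 a)//= ltr_wpDr//.
  by apply: sumr_ge0 => c _; rewrite mulr_ge0// ltW// stochastic_gt0.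
by rewrite mulr_gt0// stochastic_gt0.
Qed.

(** Either side completes the flow inside [S] to the mass of [S]: the outflow because rows sum to 1,
    the inflow by stationarity. *)
Lemma stationary_balance P p S : stochastic P -> stationary P p ->
  \sum_(a in S) \sum_(b in ~: S) p 0 a * P a b =
  \sum_(a in ~: S) \sum_(b in S) p 0 a * P a b.
Proof.
move=> PS pP.
have inflow : \sum_(b in S) p 0 b =
    \sum_(a in S) \sum_(b in S) p 0 a * P a b +
    \sum_(a in ~: S) \sum_(b in S) p 0 a * P a b.
  under eq_bigr do rewrite (stationaryE _ pP).
  rewrite exchange_big/= (bigID (mem S))/=; congr (_ + _).
  by apply: eq_bigl => a; rewrite !inE.
have outflow : \sum_(a in S) p 0 a =
    \sum_(a in S) \sum_(b in S) p 0 a * P a b +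
    \sum_(a in S) \sum_(b in ~: S) p 0 a * P a b.
  rewrite -big_split/=; apply: eq_bigr => a _.
  rewrite -[LHS]mulr1 -(stochastic_sum a PS) mulr_sumr (bigID (mem S))/=.
  by congr (_ + _); apply: eq_bigl => b; rewrite !inE.
by move: inflow; rewrite outflow => /addrI.
Qed.

Section Perturbation.
Variables (P Q : 'M[R]_d) (p q : 'rV[R]_d) (mu : R).
Hypotheses (PS : stochastic P) (QS : stochastic Q).
Hypotheses (pP : stationary P p) (qQ : stationary Q q).
Hypothesis mu01 : 0 < mu <= 1.
Hypothesis muQP : forall a b, mu * Q a b <= P a b.
Hypothesis muPQ : forall a b, mu * P a b <= Q a b.

(* The flows across a superlevel set of [p / q] balance for both chains, so the
   ratio cannot drop by more than [mu ^ 2] across its boundary. *)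
Lemma stationary_ratio_gap (theta : R) S : 0 <= theta ->
  (forall a, a \in S -> theta * q 0 a <= p 0 a) ->
  S != finset.setT -> S != finset.set0 ->
  exists2 a, a \notin S & mu ^+ 2 * theta * q 0 a <= p 0 a.
Proof.
move=> th0 Sp ST S0; have /andP[mu0 mu1] := mu01.
apply: contrapT => noa.
have lt_p a : a \in ~: S -> p 0 a < mu ^+ 2 * theta * q 0 a.
  rewrite inE => aS; rewrite ltNge; apply/negP => h.
  by apply: noa; exists a.
have [c cS] : exists c, c \in ~: S.
  by apply/set0Pn; rewrite -finset.setCT (inj_eq (@finset.setC_inj _)).
have [e eS] : exists e, e \in S by apply/set0Pn.
set F := \sum_(a in S) \sum_(b in ~: S) q 0 a * Q a b.
have out_ge : mu * theta * F <= \sum_(a in S) \sum_(b in ~: S) p 0 a * P a b.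
  rewrite mulr_sumr; apply: ler_sum => a aS.
  rewrite mulr_sumr; apply: ler_sum => b _.
  have -> : mu * theta * (q 0 a * Q a b) = theta * q 0 a * (mu * Q a b) by ring.
  apply: ler_pM => //; last exact: Sp.
    by rewrite mulr_ge0// ltW// (stationary_gt0 _ QS).
  by rewrite mulr_ge0 ?(ltW mu0)// ltW// stochastic_gt0.
(* If all states outside [S] had smaller ratios, the inflow would fall short of the outflow. The
   extra factor [mu] passes from [P] to [Q]; strictness needs [S] and its complement nonempty. *)
have in_lt : mu * (\sum_(a in ~: S) \sum_(b in S) p 0 a * P a b) <
    mu ^+ 2 * theta * F.
  rewrite /F stationary_balance// !mulr_sumr; apply: ltr_sum => [|a aS].
    by apply/hasP; exists c => //; rewrite mem_index_enum.
  rewrite !mulr_sumr; apply: ltr_sum => [|b bS].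
    by apply/hasP; exists e => //; rewrite mem_index_enum.
  apply: (@le_lt_trans _ _ (p 0 a * Q a b)).
    by rewrite mulrCA ler_wpM2l// ltW// (stationary_gt0 _ PS).
  by rewrite mulrA ltr_pM2r ?stochastic_gt0// lt_p.
move: in_lt; rewrite -stationary_balance//.
have : mu * (mu * theta * F) <=
  mu * (\sum_(a in S) \sum_(b in ~: S) p 0 a * P a b) by rewrite ler_pM2l.
have -> : mu * (mu * theta * F) = mu ^+ 2 * theta * F by ring.
lra.
Qed.

(** The superlevel set [L 0] of [p / q] is nonempty, both masses being 1. By [stationary_ratio_gap],
    lowering the threshold by [mu ^+ 2] adds a state until none is missing, so [d] rounds
    suffice. *)
Lemma stationary_ratio_ge a : mu ^+ (2 * d) * q 0 a <= p 0 a.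
Proof.
have /andP[mu0 mu1] := mu01.
pose L j := [set a | mu ^+ (2 * j) * q 0 a <= p 0 a]%SET.
suff card_L j : (minn j.+1 d <= #|L j|)%N.
  have : L d = finset.setT.
    apply/eqP; rewrite eqEcard finset.subsetT/= cardsT card_ord.
    by rewrite (leq_trans _ (card_L d))// leq_min leqnSn leqnn.
  by move/setP/(_ a); rewrite !inE.
have q0 b : 0 < q 0 b by apply: stationary_gt0 qQ.
elim: j => [|j IH].
  rewrite (leq_trans (geq_minl _ _))// card_gt0; apply/set0Pn.
  apply: contrapT => noa.
  have : \sum_b p 0 b < \sum_b q 0 b.
    apply: ltr_sum => [|b _].
      by apply/hasP; exists a => //; rewrite mem_index_enum.
    rewrite ltNge; apply/negP => h; apply: noa; exists b.
    by rewrite inE muln0 expr0 mul1r.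
  by have [[_ ->] _] := pP; have [[_ ->] _] := qQ; rewrite ltxx.
have L_sub : L j \subset L j.+1.
  apply/fintype.subsetP => b; rewrite !inE; apply: le_trans.
  rewrite ler_wpM2r ?(ltW (q0 b))// ler_wiXn2l ?(ltW mu0)//.
  by rewrite leq_mul2l leqnSn.
have [LT|LT] := eqVneq (L j) finset.setT.
  by rewrite (leq_trans (geq_minr _ _))// (leq_trans _ (subset_leq_card L_sub))//
     LT cardsT card_ord.
have L0 : L j != finset.set0.
  rewrite -card_gt0 (leq_trans _ IH)// leq_min/=.
  by rewrite (leq_ltn_trans _ (ltn_ord a)).
have [b bL hb] := @stationary_ratio_gap (mu ^+ (2 * j)) (L j)
  (exprn_ge0 _ (ltW mu0)) (fun b bS => ltac:(by rewrite inE in bS)) LT L0.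
have : L j \proper L j.+1.
  apply/properP; split=> //; exists b => //.
  by rewrite inE mulnS exprD.
move/proper_card; apply: leq_trans.
rewrite geq_min ltnS; move: IH; rewrite geq_min => /orP[->//|].
rewrite leqNgt => /negP[].
by rewrite -[X in (_ < X)%N](card_ord d) -cardsT proper_card// properT.
Qed.

End Perturbation.

(** By [stationary_ratio_ge] and Bernoulli's inequality, neither distribution falls below the other
    by more than the fraction [8 * d * e]; the total mass of [p + q] is 2. *)
Lemma stationary_l1_close P Q p q (e : R) : stochastic P -> stochastic Q ->
  stationary P p -> stationary Q q -> 0 <= e <= 1 ->
  (forall a b, (1 - e) ^+ 4 * Q a b <= P a b) ->
  (forall a b, (1 - e) ^+ 4 * P a b <= Q a b) ->
  \sum_a `|p 0 a - q 0 a| <= 16 * d%:R * e.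
Proof.
move=> PS QS pP qQ /andP[e0 e1] hQP hPQ.
have [pS _] := pP; have [qS _] := qQ.
have d1 : 1 <= d%:R :> R by rewrite ler1n (simplex_dim_gt0 pS).
(* At [e = 1] the multiplicative factor degenerates to 0, but the distance is at most 2 anyway. *)
have [->|eN1] := eqVneq e 1.
  by rewrite (le_trans (simplex_l1_dist_le2 pS qS))//; lra.
have mu0 : 0 < 1 - e by rewrite subr_gt0 lt_neqAle eN1.
have mu01 : 0 < (1 - e) ^+ 4 <= 1.
  by rewrite exprn_gt0//= exprn_ile1 ?(ltW mu0)//; lra.
have bernoulli n : 1 - n%:R * e <= (1 - e) ^+ n.
  elim: n => [|n IH]; first by rewrite expr0; lra.
  have n0 : 0 <= n%:R :> R by [].
  rewrite exprS -natr1.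
  have : (1 - e) * (1 - n%:R * e) <= (1 - e) * (1 - e) ^+ n.
    by rewrite ler_wpM2l// ltW.
  by apply: le_trans; nra.
have bd (x y : R) : 0 < y -> ((1 - e) ^+ 4) ^+ (2 * d) * y <= x ->
    y - x <= 8 * d%:R * e * y.
  move=> y0; rewrite -exprM => h.
  have : (1 - (4 * (2 * d))%:R * e) * y <= x.
    by apply: le_trans h; rewrite ler_wpM2r// ltW.
  by rewrite !natrM mulrA -natrM; lra.
have hp a := bd _ _ (stationary_gt0 a QS qQ)
  (stationary_ratio_ge PS QS pP qQ mu01 hQP hPQ a).
have hq a := bd _ _ (stationary_gt0 a PS pP)
  (stationary_ratio_ge QS PS qQ pP mu01 hPQ hQP a).
have -> : 16 * d%:R * e = \sum_a 8 * d%:R * e * (p 0 a + q 0 a).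
  by rewrite -mulr_sumr big_split/= pS.2 qS.2; ring.
have de : 0 <= 8 * d%:R * e by rewrite !mulr_ge0.
apply: ler_sum => a _; rewrite ler_norml mulrDr.
have := mulr_ge0 de (ltW (stationary_gt0 a QS qQ)).
have := mulr_ge0 de (ltW (stationary_gt0 a PS pP)).
have := hp a; have := hq a; lra.
Qed.

End MarkovStability.

(** * From Bregman movement to movement of the stationary distribution *)

Section StationaryStability.
Variables (R : realType) (d : nat).
Local Notation B := (bregman (@log_barrier R d)).

Lemma log_dev_le_bregman (x y : 'rV[R]_d) a :
  (forall b, 0 < x 0 b) -> (forall b, 0 < y 0 b) ->
  log_dev (x 0 a / y 0 a) <= B x y.
Proof.
move=> x0 y0; rewrite bregman_log_barrier// (bigD1 a)//= lerDl.
by apply: sumr_ge0 => b _; apply/log_dev_ge0/divr_gt0.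
Qed.

(** Let [s] be the root of the sum. If [s <= 1], each of the two hops between [Q a], [Z a] and [P a]
    preserves entries up to a factor [(1 - s) ^+ 2], whence the fourth power in
    [stationary_l1_close]. If [s > 1], the trivial bound 2 is enough. *)
Lemma stationary_bregman_stability (P Z Q : 'I_d -> 'rV[R]_d) (p q : 'rV[R]_d) :
  (forall a, simplex_interior (P a)) -> (forall a, simplex_interior (Z a)) ->
  (forall a, simplex_interior (Q a)) ->
  stationary (\matrix_a P a) p -> stationary (\matrix_a Q a) q ->
  \sum_a `|p 0 a - q 0 a| <=
  16 * d%:R * Num.sqrt (\sum_a (B (Q a) (Z a) + B (Z a) (P a))).
Proof.
move=> PS ZS QS pP qQ; set S := \sum_(_ < d) (_ + _).
have [pS _] := pP; have [qS _] := qQ.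
have d1 : 1 <= d%:R :> R by rewrite ler1n (simplex_dim_gt0 pS).
have BQ0 a : 0 <= B (Q a) (Z a).
  by apply: bregman_log_barrier_ge0; [case: (QS a)|case: (ZS a)].
have BZ0 a : 0 <= B (Z a) (P a).
  by apply: bregman_log_barrier_ge0; [case: (ZS a)|case: (PS a)].
have S0 : 0 <= S by apply: sumr_ge0 => a _; rewrite addr_ge0.
have BS a : B (Q a) (Z a) + B (Z a) (P a) <= S.
  rewrite /S (bigD1 a)//= lerDl; apply: sumr_ge0 => b _.
  by rewrite addr_ge0.
have s0 : 0 <= Num.sqrt S by apply: sqrtr_ge0.
have sE : S = Num.sqrt S ^+ 2 by rewrite sqr_sqrtr.
case: (lerP (Num.sqrt S) 1) => [s1|s1]; last first.
  by rewrite (le_trans (simplex_l1_dist_le2 pS qS))//; nra.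
move: (Num.sqrt S) s0 sE s1 => s s0 sE s1.
have s01 : 0 <= s <= 1 by rewrite s0.
have mus : 0 <= (1 - s) ^+ 2 by apply: sqr_ge0.
have close a b : (1 - s) ^+ 4 * Q a 0 b <= P a 0 b /\
                 (1 - s) ^+ 4 * P a 0 b <= Q a 0 b.
  have [_ Pp] := PS a; have [_ Zp] := ZS a; have [_ Qp] := QS a.
  have [|h1 h2] := log_dev_ratio_close (Qp b) (Zp b) s01.
    rewrite (le_trans (log_dev_le_bregman b Qp Zp))// -sE.
    by rewrite (le_trans _ (BS a))// lerDl.
  have [|h3 h4] := log_dev_ratio_close (Zp b) (Pp b) s01.
    rewrite (le_trans (log_dev_le_bregman b Zp Pp))// -sE.
    by rewrite (le_trans _ (BS a))// lerDr.
  have quartic x : (1 - s) ^+ 4 * x = (1 - s) ^+ 2 * ((1 - s) ^+ 2 * x) by ring.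
  split; rewrite quartic.
    by rewrite (le_trans _ h4)// ler_wpM2l.
  by rewrite (le_trans _ h1)// ler_wpM2l.
have stoch (M : 'I_d -> 'rV[R]_d) :
    (forall a, simplex_interior (M a)) -> stochastic (\matrix_a M a).
  by move=> MS a; rewrite rowK.
apply: (stationary_l1_close (stoch _ PS) (stoch _ QS) pP qQ s01) => a b;
  by rewrite !mxE; have [] := close a b.
Qed.

End StationaryStability.

(** * Lipschitz continuity of expected utilities *)

Section UtilityLipschitz.
Variables (R : realType) (n : nat) (d : 'I_n -> nat).
Implicit Types (G : game R d) (x y : mixed_profile R d).

Lemma entry_le_norm m (u : 'rV[R]_m) a : `|u 0 a| <= `|u|.
Proof.
rewrite [leRHS]mx_normrE.
exact: (@le_bigmax _ _ _ 0 (fun i : 'I_1 * 'I_m => `|u i.1 i.2|) (0, a)).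
Qed.

(* [c : 'I_(d l)] is compared with the actions of player [j] through their
   values, which avoids a cast along [j = l]. *)
Definition play_pure x (l : 'I_n) (c : 'I_(d l)) : mixed_profile R d :=
  fun j => if j == l then \row_(b < d j) (val b == val c)%:R else x j.

Lemma play_pure_eq x l (c b : 'I_(d l)) :
  play_pure x c l 0 b = (b == c)%:R.
Proof. by rewrite /play_pure eqxx mxE. Qed.

Lemma play_pure_neq x l (c : 'I_(d l)) j : j != l -> play_pure x c j = x j.
Proof. by rewrite /play_pure => /negbTE->. Qed.

Lemma play_pure_simplex x l (c : 'I_(d l)) : (forall j, simplex (x j)) ->
  forall j, simplex (play_pure x c j).
Proof.
move=> xS j; have [->|jl] := eqVneq j l; last by rewrite play_pure_neq.
split=> [b|]; first by rewrite play_pure_eq.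
under eq_bigr do rewrite play_pure_eq.
rewrite (bigD1 c)//= eqxx big1 ?addr0// => b /negbTE bc.
by rewrite bc.
Qed.

Lemma expected_utility_entry G x k a : normalized_game G ->
  (forall j, simplex (x j)) -> `|expected_utility G x k 0 a| <= 1.
Proof. by move=> NG xS; rewrite (le_trans (entry_le_norm _ _))// NG. Qed.

(** Multilinearity in the strategy of an opponent: a profile [b] contributes on the right only for
    [c = b l]. *)
Lemma expected_utility_mixture G x k l a : l != k ->
  expected_utility G x k 0 a =
  \sum_(c < d l) x l 0 c * expected_utility G (play_pure x c) k 0 a.
Proof.
move=> lk; under [RHS]eq_bigr do rewrite mxE mulr_sumr.
rewrite mxE exchange_big/=; apply: eq_bigr => b _.
rewrite (bigD1 (b l))//= [X in _ = _ + X]big1 => [|c cb]; last first.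
  by rewrite (bigD1 l)//= play_pure_eq eq_sym (negbTE cb) mul0r !mulr0.
rewrite addr0 (bigD1 l)//= [in RHS](bigD1 l)//= play_pure_eq eqxx mul1r.
rewrite mulrCA; congr (_ * (_ * _)).
by apply: eq_bigr => j /andP[_ jl]; rewrite play_pure_neq.
Qed.

(** A player's own strategy does not enter its utility vector. For an opponent [l], both sides mix
    the same pure-play utilities, which are at most 1 in absolute value. *)
Lemma expected_utility_lipschitz1 G x y k l a : normalized_game G ->
  (forall j, simplex (x j)) -> (forall j, j != l -> x j = y j) ->
  `|expected_utility G x k 0 a - expected_utility G y k 0 a| <=
  \sum_c `|x l 0 c - y l 0 c|.
Proof.
move=> NG xS xy; have [lk|lk] := eqVneq l k.
  suff -> : expected_utility G x k = expected_utility G y k.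
    by rewrite subrr normr0 sumr_ge0.
  apply/rowP => c; rewrite !mxE; apply: eq_bigr => b _; congr (_ * _).
  by apply: eq_bigr => j jk; rewrite xy// lk.
rewrite !(expected_utility_mixture _ _ _ lk) -sumrB.
rewrite (le_trans (ler_norm_sum _ _ _))//; apply: ler_sum => c _.
have <- : play_pure x c = play_pure y c.
  apply: functional_extensionality_dep => j; rewrite /play_pure.
  by case: eqP => // /eqP jl; rewrite xy.
rewrite -mulrBl normrM ler_piMr// expected_utility_entry//.
exact: play_pure_simplex.
Qed.

Lemma expected_utility_lipschitz G x y k a : normalized_game G ->
  (forall j, simplex (x j)) -> (forall j, simplex (y j)) ->
  `|expected_utility G x k 0 a - expected_utility G y k 0 a| <=
  \sum_(l < n) \sum_c `|x l 0 c - y l 0 c|.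
Proof.
move=> NG xS yS.
(* Hybrid argument: the strategies are replaced one player at a time. *)
pose hyb m : mixed_profile R d := fun j => if (j < m)%N then x j else y j.
have hybS m j : simplex (hyb m j) by rewrite /hyb; case: ifP.
have -> : x = hyb n.
  by apply: functional_extensionality_dep => j; rewrite /hyb ltn_ord.
have -> : y = hyb 0%N by apply: functional_extensionality_dep.
rewrite -(@telescope_sumr _ _ _ (fun m => expected_utility G (hyb m) k 0 a))//.
rewrite big_mkord (le_trans (ler_norm_sum _ _ _))//; apply: ler_sum => l _.
have hyb_neq j : j != l -> hyb l.+1 j = hyb l j.
  by move=> jl; rewrite /hyb ltnS leq_eqVlt (inj_eq val_inj) (negbTE jl).
have := expected_utility_lipschitz1 a NG (hybS l.+1) hyb_neq.
move=> /le_trans; apply; apply: ler_sum => c _.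
by rewrite /hyb ltnSn ltnn ltn_ord.
Qed.

End UtilityLipschitz.

(** * Total regret of all players within one game *)

Section SelfPlay.
Variables (R : realType) (n : nat) (d : 'I_n -> nat) (G : game R d).
Variables (m : nat) (eta : R) (X : nat -> mixed_profile R d).
Variables (M H : nat -> forall k : 'I_n, 'I_(d k) -> 'rV[R]_(d k)).
Arguments M : clear implicits.
Arguments H : clear implicits.

Local Notation B := (bregman (@log_barrier R _)).
Local Notation D := (\sum_(k < n) (d k)%:R : R).
Local Notation U i k := (expected_utility G (X i) k).

Hypotheses (eta_gt0 : 0 < eta) (eta_le : 64 * D ^+ 2 * eta <= 1).
Hypothesis NG : normalized_game G.
Hypothesis X_stationary : forall i k, (i <= m)%N ->
  stationary (\matrix_(a < d k) M i k a) (X i k).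
Hypothesis H0 : forall k a, H 0%N k a = M 0%N k a.
Hypothesis M0_interior : forall k a, simplex_interior (M 0%N k a).
Hypothesis M_step : forall i k (a : 'I_(d k)), (1 <= i <= m)%N ->
  omd_argmax eta (X i.-1 k 0 a *: U i.-1 k) (H i.-1 k a) (M i k a).
Hypothesis H_step : forall i k (a : 'I_(d k)), (1 <= i <= m)%N ->
  omd_argmax eta (X i k 0 a *: U i k) (H i.-1 k a) (H i k a).

Let M_interior i k a : (i <= m)%N -> simplex_interior (M i k a).
Proof. by case: i => // i im; have [] := M_step a (im : (1 <= i.+1 <= m)%N). Qed.

Let H_interior i k a : (i <= m)%N -> simplex_interior (H i k a).
Proof.
by case: i => [|i] im; [rewrite H0|have [] := H_step a (im : (1 <= i.+1 <= m)%N)].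
Qed.

Let X_simplex i k : (i <= m)%N -> simplex (X i k).
Proof. by move=> im; have [] := X_stationary k im. Qed.

Let B_ge0 k (x y : 'rV[R]_(d k)) : simplex_interior x -> simplex_interior y ->
  0 <= B x y.
Proof. by move=> [_ x0] [_ y0]; apply: bregman_log_barrier_ge0. Qed.

Let path_length i : R := \sum_(l < n) \sum_(c < d l) `|X i.+1 l 0 c - X i l 0 c|.

(** The path from [M i] to [M i.+1] through [H i], as [stationary_bregman_stability] requires.
    [omd_regret_rvu] instead pairs the step from [H i] to [M i.+1] with the next one, to
    [H i.+1]. *)
Let movement i : R := \sum_(k < n) \sum_(a < d k)
  (B (M i.+1 k a) (H i k a) + B (H i k a) (M i k a)).

Let movement_term_ge0 i k a : (i < m)%N ->
  0 <= B (M i.+1 k a) (H i k a) + B (H i k a) (M i k a).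
Proof.
move=> im; have im' := ltnW im.
by apply: addr_ge0; apply: B_ge0; rewrite ?(M_interior _ im) ?(M_interior _ im')
  ?(H_interior _ im'); auto.
Qed.

Let movement_ge0 i : (i < m)%N -> 0 <= movement i.
Proof.
move=> im; apply: sumr_ge0 => k _; apply: sumr_ge0 => a _.
exact: movement_term_ge0.
Qed.

Let D_ge0 : 0 <= D.
Proof. by apply: sumr_ge0. Qed.

Let path_length_sqr_le i : (i < m)%N ->
  path_length i ^+ 2 <= 256 * D ^+ 2 * movement i.
Proof.
move=> im; have im' := ltnW im.
have pl : path_length i <= 16 * D * Num.sqrt (movement i).
  rewrite mulr_sumr mulr_suml; apply: ler_sum => l _.
  under eq_bigr do rewrite distrC.
  apply: le_trans (stationary_bregman_stability (Z := fun a => H i l a)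
    (fun a => M_interior _ im') (fun a => H_interior _ im')
    (fun a => M_interior _ im) (X_stationary l im') (X_stationary l im)) _.
  rewrite ler_wpM2l// ler_wsqrtr// /movement (bigD1 l)//= lerDl.
  by apply: sumr_ge0 => k _; apply: sumr_ge0 => a _; apply: movement_term_ge0.
have p0 : 0 <= path_length i.
  by apply: sumr_ge0 => l _; apply: sumr_ge0.
have -> : 256 * D ^+ 2 * movement i = (16 * D * Num.sqrt (movement i)) ^+ 2.
  by rewrite !exprMn sqr_sqrtr ?movement_ge0//; congr (_ * _ * _); ring.
by rewrite ler_sqr// nnegrE// (le_trans p0).
Qed.

Let utility_variation i k (a b : 'I_(d k)) : (i < m)%N ->
  `|X i.+1 k 0 a * U i.+1 k 0 b - X i k 0 a * U i k 0 b| <= 2 * path_length i.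
Proof.
move=> im; have im' := ltnW im.
have -> : X i.+1 k 0 a * U i.+1 k 0 b - X i k 0 a * U i k 0 b =
  (X i.+1 k 0 a - X i k 0 a) * U i.+1 k 0 b +
  X i k 0 a * (U i.+1 k 0 b - U i k 0 b) by ring.
rewrite mulr_natl mulr2n (le_trans (ler_normD _ _))//; apply: lerD.
  rewrite normrM (@le_trans _ _ `|X i.+1 k 0 a - X i k 0 a|)//.
    by rewrite ler_piMr// expected_utility_entry// => j; apply: X_simplex.
  rewrite /path_length (bigD1 k)//= (bigD1 a)//= -addrA lerDl.
  by rewrite addr_ge0// sumr_ge0// => l _; apply: sumr_ge0.
rewrite normrM -[leRHS]mul1r ler_pM//.
  have Xs := X_simplex k im'.
  by rewrite ger0_norm ?simplex_le1//; case: Xs.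
by apply: expected_utility_lipschitz => // j; apply: X_simplex.
Qed.

(** AM-GM with weights chosen so that, after strong convexity [bregman_log_barrier_ge_sqr], only
    half of the available [eta^-1 * B] is spent; the other half remains for the telescoping in
    [self_play_regret_le]. *)
Let variation_term_le i k (a : 'I_(d k)) : (i < m)%N ->
  dot (H i.+1 k a - M i.+1 k a) (X i.+1 k 0 a *: U i.+1 k - X i k 0 a *: U i k)
  <= (2 * eta)^-1 * B (H i.+1 k a) (M i.+1 k a)
     + 8 * eta * (d k)%:R * path_length i ^+ 2.
Proof.
move=> im; have eta0 : eta != 0 by rewrite gt_eqF.
have BH := bregman_log_barrier_ge_sqr (H_interior a im) (M_interior a im).
apply: (@le_trans _ _ ((8 * eta)^-1 *
    \sum_b (H i.+1 k a 0 b - M i.+1 k a 0 b) ^+ 2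
    + 8 * eta * (d k)%:R * path_length i ^+ 2)); last first.
  rewrite lerD2r.
  have -> : (2 * eta)^-1 * B (H i.+1 k a) (M i.+1 k a) =
    (8 * eta)^-1 * (4 * B (H i.+1 k a) (M i.+1 k a)) by field.
  by rewrite ler_wpM2l// invr_ge0 mulr_ge0// ltW.
have -> : 8 * eta * (d k)%:R * path_length i ^+ 2 =
    \sum_(b < d k) 8 * eta * path_length i ^+ 2.
  by rewrite sumr_const card_ord -mulr_natr; ring.
rewrite mulr_sumr -big_split/=; apply: ler_sum => b _.
rewrite !mxE; have := utility_variation a b im; rewrite !mxE.
move: (_ - X i k 0 a * _) (H i.+1 k a 0 b - _) (path_length i) => v h p.
rewrite ler_norml => /andP[v1 v2].
have v3 : v ^+ 2 <= 4 * p ^+ 2 by nra.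
(* AM-GM: [h v <= h^2 / (8 eta) + 2 eta v^2] *)
have amgm : 0 <= (8 * eta)^-1 * (h - 4 * eta * v) ^+ 2.
  by rewrite mulr_ge0 ?sqr_ge0// invr_ge0 mulr_ge0// ltW.
have E : (8 * eta)^-1 * (h - 4 * eta * v) ^+ 2 =
  (8 * eta)^-1 * h ^+ 2 - h * v + 2 * eta * v ^+ 2 by field.
rewrite E in amgm.
have : 2 * eta * v ^+ 2 <= 2 * eta * (4 * p ^+ 2).
  by rewrite ler_wpM2l// mulr_ge0// ltW.
lra.
Qed.

(** Here the smallness of [eta] enters: [path_length_sqr_le] turns the left side into at most
    [(64 * D ^+ 2 * eta) ^+ 2] times the right side. *)
Let variation_le i : (i < m)%N ->
  \sum_(k < n) \sum_(a < d k) 8 * eta * (d k)%:R * path_length i ^+ 2 <=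
  (2 * eta)^-1 * movement i.
Proof.
move=> im; have S0 := movement_ge0 im; have p2 := path_length_sqr_le im.
have eta0 : eta != 0 by rewrite gt_eqF.
have dD k : (d k)%:R <= D by rewrite (bigD1 k)//= lerDl sumr_ge0.
apply: (@le_trans _ _ (8 * eta * D ^+ 2 * path_length i ^+ 2)).
  have -> : 8 * eta * D ^+ 2 * path_length i ^+ 2 =
      \sum_(k < n) 8 * eta * path_length i ^+ 2 * D * (d k)%:R.
    by rewrite -mulr_sumr; ring.
  apply: ler_sum => k _; rewrite sumr_const card_ord -[_ *+ d k]mulr_natr.
  have q0 : 0 <= 8 * eta * path_length i ^+ 2.
    by rewrite mulr_ge0 ?sqr_ge0 ?mulr_ge0 ?(ltW eta_gt0).
  by rewrite [_ * _ * path_length i ^+ 2]mulrAC ler_wpM2r// ler_wpM2l.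
apply: (@le_trans _ _ (8 * eta * D ^+ 2 * (256 * D ^+ 2 * movement i))).
  by rewrite ler_wpM2l// !mulr_ge0// ?sqr_ge0// ltW.
have -> : 8 * eta * D ^+ 2 * (256 * D ^+ 2 * movement i) =
  (2 * eta)^-1 * ((64 * D ^+ 2 * eta) ^+ 2 * movement i).
  by field.
rewrite ler_wpM2l// ?invr_ge0 ?mulr_ge0 ?(ltW eta_gt0)//.
rewrite ler_piMl// exprn_ile1// !mulr_ge0// ?sqr_ge0//; exact: ltW.
Qed.

Lemma self_play_regret_le (z : forall k, 'I_(d k) -> 'rV[R]_(d k)) :
  (forall k a, simplex_interior (z k a)) ->
  \sum_(k < n) \sum_(a < d k) \sum_(1 <= i < m.+1)
    dot (z k a - M i k a) (X i k 0 a *: U i k) <=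
  eta^-1 * \sum_(k < n) \sum_(a < d k) B (z k a) (M 0%N k a).
Proof.
move=> zS; have eta0 : eta != 0 by rewrite gt_eqF.
pose V i k (a : 'I_(d k)) := dot (H i.+1 k a - M i.+1 k a)
    (X i.+1 k 0 a *: U i.+1 k - X i k 0 a *: U i k)
  - eta^-1 * (B (M i.+1 k a) (H i k a) + B (H i.+1 k a) (M i.+1 k a)).
have rvu k a : \sum_(1 <= i < m.+1) dot (z k a - M i k a) (X i k 0 a *: U i k)
    <= eta^-1 * B (z k a) (M 0%N k a) + \sum_(0 <= i < m) V i k a.
  have := @omd_regret_rvu _ _ _ eta_gt0 m (fun i => X i k 0 a *: U i k)
    (fun i => M i k a) (fun i => H i k a) (z k a) (zS k a).
  rewrite H0 => /(_ (M0_interior a) (fun i => @M_step i k a) (fun i => @H_step i k a)).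
  by rewrite [X in _ <= _ + X]big_add1/=.
(* The variation costs [W i] through [movement i], while the negative terms supply [W i.+1], with
   the same coefficient [(2 * eta)^-1]; the discrepancy telescopes, starting from [W 0 = 0]. *)
pose W i := \sum_(k < n) \sum_(a < d k) B (H i k a) (M i k a).
have VW i : (i < m)%N ->
    \sum_(k < n) \sum_(a < d k) V i k a <= (2 * eta)^-1 * (W i - W i.+1).
  move=> im.
  have vl := variation_le im.
  have : \sum_(k < n) \sum_(a < d k) V i k a <=
    \sum_(k < n) \sum_(a < d k) (8 * eta * (d k)%:R * path_length i ^+ 2 +
      (- (eta^-1 * B (M i.+1 k a) (H i k a)) -
        (2 * eta)^-1 * B (H i.+1 k a) (M i.+1 k a))).
    apply: ler_sum => k _; apply: ler_sum => a _.
    have := variation_term_le a im; rewrite /V.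
    have -> : eta^-1 * (B (M i.+1 k a) (H i k a) + B (H i.+1 k a) (M i.+1 k a)) =
       eta^-1 * B (M i.+1 k a) (H i k a) +
       2 * ((2 * eta)^-1 * B (H i.+1 k a) (M i.+1 k a)) by field.
    lra.
  move=> /le_trans; apply.
  under eq_bigr do rewrite big_split/=.
  rewrite big_split/= (le_trans (lerD vl (lexx _)))//.
  rewrite /movement /W mulrBr !mulr_sumr -sumrB -big_split/=.
  apply: ler_sum => k _; rewrite !mulr_sumr -sumrB -big_split/=.
  apply: ler_sum => a _.
  have b0 : 0 <= B (M i.+1 k a) (H i k a).
    by apply: B_ge0; [apply: M_interior|apply/H_interior/ltnW].
  have e0 : 0 <= (2 * eta)^-1 * B (M i.+1 k a) (H i k a).
    by rewrite mulr_ge0// invr_ge0 mulr_ge0// ltW.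
  have -> : eta^-1 * B (M i.+1 k a) (H i k a) =
    2 * ((2 * eta)^-1 * B (M i.+1 k a) (H i k a)) by field.
  rewrite mulrDr; lra.
apply: (le_trans (ler_sum _ (fun k _ => ler_sum _ (fun a _ => rvu k a)))).
under eq_bigr do rewrite big_split/= -mulr_sumr.
rewrite big_split/= -mulr_sumr -[leRHS]addr0 lerD2l.
under eq_bigr do rewrite exchange_big/=.
rewrite exchange_big/=.
apply: (@le_trans _ _ (\sum_(0 <= i < m) (2 * eta)^-1 * (W i - W i.+1))).
  by apply: ler_sum_nat => i /= im; apply: VW.
rewrite -mulr_sumr -(opprK (\sum_(_ <- _) _)) -sumrN.
under eq_bigr do rewrite opprB.
rewrite telescope_sumr// mulrN oppr_le0 mulr_ge0//.
  by rewrite invr_ge0 mulr_ge0// ltW.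
have -> : W 0%N = 0.
  rewrite /W big1// => k _; rewrite big1// => a _.
  by rewrite H0 /bregman !subrr /dot big1 ?subrr// => b _; rewrite !mxE mulr0.
rewrite subr0; apply: sumr_ge0 => k _; apply: sumr_ge0 => a _.
by apply: B_ge0; [apply: H_interior|apply: M_interior].
Qed.

End SelfPlay.

(** * Follow-the-leader for Bregman losses *)

Section FollowTheLeader.
Variables (R : realType) (d : nat).
Implicit Types (f : 'rV[R]_d -> R) (x : nat -> 'rV[R]_d) (q : 'rV[R]_d).

Definition prefix_mean x N : 'rV[R]_d := N%:R^-1 *: \sum_(1 <= s < N.+1) x s.

Lemma prefix_mean_sum x N : (0 < N)%N ->
  \sum_(1 <= s < N.+1) x s = N%:R *: prefix_mean x N.
Proof. by move=> N0; rewrite scalerA divff ?scale1r// pnatr_eq0 -lt0n. Qed.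

(** The three-point identity leaves a term linear in the deviations from the mean, and these sum to
    0. *)
Lemma bregman_bias_variance f x N q : (0 < N)%N ->
  \sum_(1 <= s < N.+1) bregman f (x s) q =
  \sum_(1 <= s < N.+1) bregman f (x s) (prefix_mean x N) +
  N%:R * bregman f (prefix_mean x N) q.
Proof.
move=> N0; set mu := prefix_mean x N.
have sum_dev g : \sum_(1 <= s < N.+1) dot g (x s - mu) = 0.
  rewrite -dot_sumr sumrB prefix_mean_sum// sumr_const_nat subn1/= -/mu.
  by rewrite scaler_nat subrr /dot big1// => a _; rewrite mxE mulr0.
have -> : N%:R * bregman f mu q = \sum_(1 <= s < N.+1) bregman f mu q.
  by rewrite sumr_const_nat subn1 mulr_natl.
rewrite -big_split/=; apply/eqP; rewrite -subr_eq0 -sumrB.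
under eq_bigr do rewrite opprD addrA bregman_three_point.
by rewrite sum_dev.
Qed.

(** An exact identity: adding round [t] moves the best fixed point from [q t] to the new mean, and
    [bregman_bias_variance] measures the gain. The value [q 1] is free. *)
Lemma follow_the_leader_regret f x (q : nat -> 'rV[R]_d) N :
  (forall t, (2 <= t <= N)%N -> q t = prefix_mean x t.-1) -> (0 < N)%N ->
  \sum_(1 <= t < N.+1) bregman f (x t) (q t) =
  \sum_(1 <= t < N.+1) bregman f (x t) (prefix_mean x N) +
  \sum_(1 <= t < N.+1) t%:R * bregman f (prefix_mean x t) (q t).
Proof.
elim: N => // -[_ _ _|N IH hq _].
  by have := @bregman_bias_variance f x 1 (q 1%N) isT; rewrite !big_nat1.
rewrite big_nat_recr//= IH// => [|t /andP[t2 tN]]; last first.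
  by rewrite hq// t2 leqW.
rewrite [in RHS](@big_nat_recr _ _ _ _ _ (fun t => t%:R * _))//=.
rewrite (_ : q N.+2 = prefix_mean x N.+1) ?hq ?leqnn//.
have := @bregman_bias_variance f x N.+2 (prefix_mean x N.+1) isT.
rewrite [in LHS](@big_nat_recr _ _ _ _ _
  (fun t => bregman f (x t) (prefix_mean x N.+1)))//=.
lra.
Qed.

(** The increment of [ln] from [N.+1] to [N.+2] is at least [N.+2%:R^-1], by [ln_le_sub1] at their
    quotient. *)
Lemma harmonic_sum_le N : (0 < N)%N ->
  \sum_(1 <= t < N.+1) t%:R^-1 <= 1 + ln N%:R :> R.
Proof.
elim: N => // -[_ _|N IH _]; first by rewrite big_nat1 invr1 ln1 addr0.
rewrite big_nat_recr//= (le_trans (lerD (IH isT) (lexx _)))//.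
rewrite -addrA lerD2l -lerBrDl -[leRHS]opprB lerNr.
rewrite -ln_div ?posrE// (le_trans (ln_le_sub1 _))// ?divr_gt0//.
have -> : N.+1%:R / N.+2%:R = 1 - N.+2%:R^-1 :> R.
  apply: (mulIf (x := N.+2%:R)); first by rewrite pnatr_eq0.
  by rewrite mulrBl mul1r divfK ?mulVf ?pnatr_eq0// -[in RHS]natr1 addrK.
by rewrite addrAC subrr add0r.
Qed.

Lemma simplex_sqr_dist_le2 (x y : 'rV[R]_d) : simplex x -> simplex y ->
  \sum_(a < d) (x 0 a - y 0 a) ^+ 2 <= 2.
Proof.
move=> xS yS; apply: (le_trans _ (simplex_l1_dist_le2 xS yS)).
apply: ler_sum => a _; rewrite -real_normK ?num_real// expr2 ler_piMl//.
have x1 := simplex_le1 a xS; have y1 := simplex_le1 a yS.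
case: xS => /(_ a) x0 _; case: yS => /(_ a) y0 _.
by rewrite ler_norml; lra.
Qed.

Lemma prefix_mean_simplex x N : (0 < N)%N ->
  (forall t, (1 <= t <= N)%N -> simplex (x t)) -> simplex (prefix_mean x N).
Proof.
move=> N0 xS; have N0' : N%:R != 0 :> R by rewrite pnatr_eq0 -lt0n.
split=> [a|].
  rewrite mxE summxE mulr_ge0 ?invr_ge0// big_nat sumr_ge0// => t tN.
  by have [] := xS t tN.
under eq_bigr do rewrite mxE summxE.
rewrite -mulr_sumr exchange_big/= big_nat (eq_bigr (fun=> 1)); last first.
  by move=> t tN; have [] := xS t tN.
by rewrite -big_nat sumr_const_nat subn1/= mulVf.
Qed.

Lemma prefix_mean_ge (c : R) x N a : (0 < N)%N ->
  (forall t, (1 <= t <= N)%N -> c <= x t 0 a) -> c <= prefix_mean x N 0 a.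
Proof.
move=> N0 xc; rewrite mxE summxE mulrC ler_pdivlMr ?ltr0n//.
have -> : c * N%:R = \sum_(1 <= t < N.+1) c.
  by rewrite sumr_const_nat subn1/= mulr_natr.
exact: ler_sum_nat.
Qed.

(** The mean moves by [(x t - q t) / t] in round [t], so the excess term is at most
    [t * c ^- 2 * 2 / t ^ 2], and a harmonic sum results. *)
Lemma follow_the_leader_log_barrier (c : R) x (q : nat -> 'rV[R]_d) N :
  (0 < N)%N -> 0 < c ->
  (forall t, (1 <= t <= N)%N -> simplex (x t)) ->
  (forall t a, (1 <= t <= N)%N -> c <= x t 0 a) ->
  simplex (q 1%N) -> (forall a, c <= q 1%N 0 a) ->
  (forall t, (2 <= t <= N)%N -> q t = prefix_mean x t.-1) ->
  \sum_(1 <= t < N.+1) bregman (@log_barrier R d) (x t) (q t) <=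
  \sum_(1 <= t < N.+1) bregman (@log_barrier R d) (x t) (prefix_mean x N) +
  2 * c ^- 2 * (1 + ln N%:R).
Proof.
move=> N0 c0 xS xc q1S q1c hq.
rewrite (follow_the_leader_regret _ hq)// lerD2l.
apply: (@le_trans _ _ (\sum_(1 <= t < N.+1) 2 * c ^- 2 * t%:R^-1)); last first.
  rewrite -mulr_sumr ler_wpM2l ?harmonic_sum_le// mulr_ge0// invr_ge0.
  by rewrite exprn_ge0// ltW.
apply: ler_sum_nat => t /= /andP[t1]; rewrite ltnS => tN.
have wd s : (1 <= s <= t)%N -> (1 <= s <= N)%N.
  by case/andP=> -> /leq_trans ->.
have muc a : c <= prefix_mean x t 0 a.
  by apply: prefix_mean_ge => // s /wd; apply: xc.
have [qS qc] : simplex (q t) /\ forall a, c <= q t 0 a.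
  case: t t1 tN wd muc => // -[//|t] _ tN wd _.
  have wd' s : (1 <= s <= t.+1)%N -> (1 <= s <= N)%N.
    by move=> /andP[s1 /leqW st]; apply: wd; rewrite s1.
  rewrite hq; last by rewrite tN.
  split=> [|a]; first by apply: prefix_mean_simplex => // s /wd'; apply: xS.
  by apply: prefix_mean_ge => // s /wd'; apply: xc.
have t0 : 0 < t%:R :> R by rewrite ltr0n.
have tN0 : t%:R != 0 :> R by rewrite gt_eqF.
have step a : prefix_mean x t 0 a - q t 0 a = t%:R^-1 * (x t 0 a - q t 0 a).
  (* [q 1] is no prefix mean, but the mean of one point is [x 1], so the formula holds for [t = 1]
     as well. *)
  have [->|tN1] := eqVneq t 1%N.
    by rewrite /prefix_mean big_nat1 mxE invr1 !mul1r.
  have t2 : (2 <= t)%N by case: t t1 tN1 {tN wd muc qS qc t0 tN0} => [|[|]].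
  have t'N0 : (t.-1)%:R != 0 :> R by rewrite pnatr_eq0 -lt0n -subn1 subn_gt0.
  have -> : prefix_mean x t = t%:R^-1 *: ((t.-1)%:R *: q t + x t).
    rewrite /prefix_mean big_nat_recr//= hq ?t2//.
    by rewrite -prefix_mean_sum ?prednK// -subn1 subn_gt0.
  have -> : (t.-1)%:R = t%:R - 1 :> R by rewrite -subn1 natrB.
  by rewrite !mxE; field.
apply: (@le_trans _ _ (t%:R * (c ^- 2 * (t%:R ^- 2 * 2)))).
  rewrite ler_wpM2l ?(ltW t0)//.
  apply: (le_trans (bregman_log_barrier_le_sqr c0 muc qc)).
  rewrite ler_wpM2l ?invr_ge0 ?exprn_ge0 ?(ltW c0)//.
  under eq_bigr do rewrite step exprMn exprVn.
  rewrite -mulr_sumr ler_wpM2l ?invr_ge0 ?exprn_ge0 ?(ltW t0)//.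
  by apply: simplex_sqr_dist_le2 => //; apply: xS; rewrite t1.
have cN0 : c != 0 by rewrite gt_eqF.
by rewrite le_eqVlt; apply/orP; left; apply/eqP; field; rewrite ?tN0 ?cN0.
Qed.

End FollowTheLeader.

(** * Reduction of swap regret to the individual minimizers *)

Section SwapRegret.
Variables (R : realType) (d : nat).
Implicit Types x y u : 'rV[R]_d.

Lemma vertex_simplex (c : 'I_d) : simplex (delta_mx 0 c : 'rV[R]_d).
Proof.
split=> [a|]; first by rewrite mxE.
rewrite (bigD1 c)//= mxE !eqxx big1 ?addr0// => a /negbTE ac.
by rewrite mxE ac andbF.
Qed.

(** The maximum is attained at a vertex. Nonemptiness is what makes a tie rule return a true
    maximizer. *)
Lemma argmax_linear_nonempty (m : nat) (w : nat -> 'rV[R]_d) : (0 < d)%N ->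
  argmax (@simplex R d) (fun y => \sum_(1 <= i < m.+1) dot y (w i)) !=set0.
Proof.
move=> d0; pose W := \sum_(1 <= i < m.+1) w i.
case: (arg_maxP (fun c => W 0 c) (isT : xpredT (Ordinal d0))) => c _ cmax.
exists (delta_mx 0 c); split=> [|y [y0 y1]]; first exact: vertex_simplex.
rewrite -!dot_sumr -/W.
have -> : dot (delta_mx 0 c) W = W 0 c.
  rewrite /dot (bigD1 c)//= mxE !eqxx mul1r big1 ?addr0// => a /negbTE ac.
  by rewrite mxE ac andbF mul0r.
rewrite -[leRHS]mul1r -y1 mulr_suml; apply: ler_sum => a _.
by rewrite ler_wpM2l//; apply: cmax.
Qed.

Lemma mix_uniform_ge (alpha : R) x a : alpha <= 1 -> simplex x ->
  alpha / d%:R <= mix_uniform alpha x 0 a.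
Proof.
move=> a1 [x0 _]; rewrite !mxE lerDr mulr_ge0// subr_ge0//.
Qed.

Lemma uniform_simplex : (0 < d)%N -> simplex (uniform R d).
Proof.
move=> d0; split=> [a|]; first by rewrite mxE invr_ge0.
under eq_bigr do rewrite mxE.
by rewrite sumr_const card_ord -(mulr_natr d%:R^-1) mulVf// pnatr_eq0 -lt0n.
Qed.

Lemma mix_uniform_simplex (alpha : R) x : 0 <= alpha <= 1 -> simplex x ->
  simplex (mix_uniform alpha x).
Proof.
move=> /andP[a0 a1] xS.
have [u0 u1] := uniform_simplex (simplex_dim_gt0 xS).
have [x0 x1] := xS; split=> [a|].
  rewrite mxE addr_ge0// mxE mulr_ge0// subr_ge0//.
under eq_bigr do rewrite mxE mxE [X in _ + X]mxE.
by rewrite big_split/= -!mulr_sumr x1 u1; ring.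
Qed.

Section Bound.
Variables (m : nat) (x u : nat -> 'rV[R]_d) (M : nat -> 'I_d -> 'rV[R]_d).
Variables (o : 'I_d -> 'rV[R]_d).
Hypothesis x_stationary : forall i, (1 <= i <= m)%N ->
  stationary (\matrix_(a < d) M i a) (x i).
Hypothesis o_argmax : forall a, argmax (@simplex R d)
  (fun y => \sum_(1 <= i < m.+1) dot y (x i 0 a *: u i)) (o a).

(* A linear map is a choice of a target [phi e_a] for every action [a], and
   stationarity splits [x i] into the recommendations [M i a] accordingly. *)
Lemma swap_deviation_le (phi : {linear 'rV[R]_d -> 'rV[R]_d}) :
  (forall y, simplex y -> simplex (phi y)) ->
  \sum_(1 <= i < m.+1) dot (phi (x i) - x i) (u i) <=
  \sum_(a < d) \sum_(1 <= i < m.+1) dot (o a - M i a) (x i 0 a *: u i).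
Proof.
move=> phiS.
have split_dev i : (1 <= i < m.+1)%N -> dot (phi (x i) - x i) (u i) =
    \sum_(a < d) dot (phi (delta_mx 0 a) - M i a) (x i 0 a *: u i).
  move=> im; have [_ xE] := x_stationary im.
  have phiE : phi (x i) = \sum_a x i 0 a *: phi (delta_mx 0 a).
    rewrite {1}(row_sum_delta (x i)) linear_sum; apply: eq_bigr => a _.
    by rewrite linearZ.
  have xME : x i = \sum_a x i 0 a *: M i a.
    rewrite -{1}xE mulmx_sum_row; apply: eq_bigr => a _.
    by rewrite rowK.
  rewrite phiE {2}xME -sumrB dot_suml; apply: eq_bigr => a _.
  by rewrite -scalerBr dotZl dotZr.
rewrite (eq_big_nat _ _ split_dev) exchange_big/=; apply: ler_sum => a _.
under eq_bigr do rewrite dotBl.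
under [leRHS]eq_bigr do rewrite dotBl.
rewrite !sumrB lerD2r; have [_] := o_argmax a; apply.
exact/phiS/vertex_simplex.
Qed.

(** Mixing the comparator of action [a] with the uniform distribution costs at most
    [2 * alpha * x i 0 a] in iteration [i], and these weights sum to 1 over [a]. *)
Lemma swap_regret_bounds (alpha : R) : 0 <= alpha ->
  (forall i a, (1 <= i <= m)%N -> `|u i 0 a| <= 1) ->
  0 <= swap_regret m x u <= 2 * alpha * m%:R +
  \sum_(a < d) \sum_(1 <= i < m.+1)
     dot (mix_uniform alpha (o a) - M i a) (x i 0 a *: u i).
Proof.
move=> alpha0 u1.
set b := \sum_(a < d) \sum_(1 <= i < m.+1) dot (o a - M i a) (x i 0 a *: u i).
have ub : ubound [set r | exists phi : {linear 'rV[R]_d -> 'rV[R]_d},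
    (forall y, simplex y -> simplex (phi y)) /\
    r = \sum_(1 <= i < m.+1) dot (phi (x i) - x i) (u i)] b.
  by move=> _ [phi [phiS ->]]; apply: swap_deviation_le.
(* The identity map gives the lower bound 0, and also the nonemptiness without which [sup] could not
   be bounded by [b]. *)
have id_dev : exists phi : {linear 'rV[R]_d -> 'rV[R]_d},
    (forall y, simplex y -> simplex (phi y)) /\
    0 = \sum_(1 <= i < m.+1) dot (phi (x i) - x i) (u i).
  exists idfun; split=> //.
  rewrite big1// => i _; rewrite /= subrr /dot big1// => a _.
  by rewrite mxE mul0r.
apply/andP; split; first by apply: ub_le_sup => //; exists b.
apply: (@le_trans _ _ b); first by apply: ge_sup => //; exists 0.
have -> : 2 * alpha * m%:R =
    \sum_(a < d) \sum_(1 <= i < m.+1) 2 * alpha * x i 0 a.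
  rewrite exchange_big/=.
  under eq_big_nat => i im do rewrite -mulr_sumr (x_stationary im).1.2 mulr1.
  by rewrite sumr_const_nat subn1/= mulr_natr.
rewrite -big_split/=; apply: ler_sum => a _.
rewrite -big_split/=; apply: ler_sum_nat => i /= im.
have [[xi0 _] _] := x_stationary im.
have [oS _] := o_argmax a.
have -> : dot (o a - M i a) (x i 0 a *: u i) =
  alpha * x i 0 a * dot (o a - uniform R d) (u i) +
  dot (mix_uniform alpha (o a) - M i a) (x i 0 a *: u i).
  have -> : mix_uniform alpha (o a) = o a - alpha *: (o a - uniform R d).
    by apply/rowP => c; rewrite !mxE; ring.
  by rewrite !(dotBl, dotZl, dotZr); ring.
rewrite lerD2r.
have d2 : dot (o a - uniform R d) (u i) <= 2.
  apply: le_trans (simplex_l1_dist_le2 oS (uniform_simplex (simplex_dim_gt0 oS))).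
  apply: ler_sum => c _; rewrite mxE [X in _ + X]mxE.
  rewrite (le_trans (ler_norm _))// normrM ler_piMr//; exact: u1.
have -> : 2 * alpha * x i 0 a = alpha * x i 0 a * 2 by ring.
by rewrite ler_wpM2l// mulr_ge0.
Qed.

End Bound.
End SwapRegret.

(** * Balancing the mixing rate and assembling the bound *)

(** The choice of [alpha] equalizes the mixing cost, of order [alpha * m], and the initialization
    cost, of order [alpha ^- 2 / T]. *)
Lemma mixing_rate_powers (R : realType) (m T : nat) : (0 < m)%N -> (0 < T)%N ->
  let alpha : R := (m * T)%:R `^ (- (1 / 3)) in
  let K : R := m%:R `^ (2 / 3) / T%:R `^ (1 / 3) in
  [/\ 0 < alpha <= 1, alpha * m%:R = K & T%:R^-1 * alpha ^- 2 = K].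
Proof.
move=> m0 T0 alpha K.
(* In terms of the cube roots [p] of [m] and [q] of [T], all claims become rational. *)
have root (N : nat) : (0 < N)%N -> exists p : R,
    [/\ N%:R `^ (1 / 3) = p, N%:R `^ (2 / 3) = p ^+ 2, N%:R = p ^+ 3 & 1 <= p].
  move=> N0; exists (N%:R `^ (1 / 3)); split=> //.
  - by rewrite -powR_mulrn ?powR_ge0// -powRrM; congr (_ `^ _); field.
  - rewrite -powR_mulrn ?powR_ge0// -powRrM.
    by have -> : 1 / 3 * 3%:R = 1 :> R; [field|rewrite powRr1].
  - rewrite -[leLHS](powRr0 (N%:R : R)) ler_powR ?ler1n//; lra.
have [p [p1 p2 p3 p4]] := root _ m0; have [q [q1 q2 q3 q4]] := root _ T0.
have alphaE : alpha = (p * q)^-1.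
  by rewrite /alpha natrM powRN powRM ?p1 ?q1.
have pq0 : p != 0 /\ q != 0 by split; rewrite gt_eqF//; lra.
have [pN0 qN0] := pq0.
rewrite /K p2 q1 alphaE p3 q3; split.
- rewrite invr_gt0 invf_le1; last by nra.
  by apply/andP; split; nra.
- by field; rewrite pN0 qN0.
- by field; rewrite pN0 qN0.
Qed.

Theorem theoremD10 (R : realType) (n : nat) (d : 'I_n -> nat)
    (n_gt0 : (0 < n)%N) (d_gt0 : forall k, (0 < d k)%N) :
  exists eta0 : R, 0 < eta0 /\
  forall (m T : nat) (G : nat -> game R d) (eta : R)
         (tie : tie_rule R d) (tr : trajectory R d),
    (0 < m)%N -> (0 < T)%N ->
    (forall t, (1 <= t <= T)%N -> normalized_game (G t)) ->
    0 < eta <= eta0 ->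
    is_tie_rule tie ->
    let alpha : R := (m * T)%:R `^ (- (1 / 3)) in
    blum_mansour_omd m T G alpha eta tie tr ->
    forall k : 'I_n,
      average_swap_regret m T G tr k <=
        eta^-1 * (\sum_(k' < n) \sum_(a < d k')
                    task_similarity_sq m T G alpha tie tr a)
        + (m%:R `^ (2 / 3) / T%:R `^ (1 / 3)) *
          (2 * n%:R +
           \sum_(k' < n) (8 * (d k')%:R ^+ 3 * (1 + ln T%:R)) / eta).
Proof.
pose D : R := \sum_(k < n) (d k)%:R.
have D_gt0 : 0 < D.
  rewrite /D (bigD1 (Ordinal n_gt0))//= ltr_wpDr ?ltr0n//.
  exact: sumr_ge0.
(* The threshold demanded by [self_play_regret_le], with [D] the total number of actions of all
   players. *)
exists (64 * D ^+ 2)^-1; split; first by rewrite invr_gt0 mulr_gt0// exprn_gt0.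
move=> m T G eta tie tr m0 T0 NG /andP[eta0 eta_le] tieP alpha tr_alg k.
have [/andP[alpha0 alpha1] alpha_m alpha_T] := mixing_rate_powers R m0 T0.
rewrite -/alpha in alpha0 alpha1 alpha_m alpha_T.
move: (m%:R `^ (2 / 3) / _) alpha_m alpha_T => K alpha_m alpha_T.
have [X_stat hat0 first_game next_game M_step H_step] := tr_alg.
have {}eta_le : 64 * D ^+ 2 * eta <= 1.
  rewrite mulrC -ler_pdivlMr ?mul1r//.
  by rewrite mulr_gt0// exprn_gt0.
have alpha01 : 0 <= alpha <= 1 by rewrite ltW.
pose opt t j (a : 'I_(d j)) := mixed_opt m G alpha tie tr t a.
have hindsight_argmax t j (a : 'I_(d j)) : argmax (@simplex R (d j))
    (fun y => \sum_(1 <= i < m.+1) dot y (minimizer_utility G tr t i a))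
    (hindsight_opt m G tie tr t a).
  by apply: tieP; exact: argmax_linear_nonempty (d_gt0 j).
have opt_simplex t j a : simplex (opt t j a).
  by apply: mix_uniform_simplex => //; have [] := hindsight_argmax t j a.
have opt_ge t j a b : alpha / (d j)%:R <= opt t j a 0 b.
  by apply: mix_uniform_ge => //; have [] := hindsight_argmax t j a.
have c_gt0 j : 0 < alpha / (d j)%:R by rewrite divr_gt0// ltr0n.
have opt_interior t j a : simplex_interior (opt t j a).
  by split=> // b; apply: lt_le_trans (opt_ge t j a b).
have unif_ge j b : alpha / (d j)%:R <= uniform R (d j) 0 b.
  by rewrite mxE ler_piMl.
have M0_mean t j (a : 'I_(d j)) : (2 <= t <= T)%N ->
    minimizer tr t 0 a = prefix_mean (fun s => opt s j a) t.-1.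
  move=> tT; rewrite next_game// /prefix_mean prednK//.
  by case/andP: tT => /ltnW.
have M0_interior t j (a : 'I_(d j)) : (1 <= t <= T)%N ->
    simplex_interior (minimizer tr t 0 a).
  case: t => // -[_|t tT]; rewrite ?first_game.
    split=> [|b]; first exact: uniform_simplex.
    exact: lt_le_trans (unif_ge j b).
  rewrite M0_mean//; split=> [|b]; first exact: prefix_mean_simplex.
  by apply: lt_le_trans (c_gt0 j) _; apply: prefix_mean_ge.
pose regret t j := \sum_(a < d j) \sum_(1 <= i < m.+1)
  dot (opt t j a - minimizer tr t i a) (minimizer_utility G tr t i a).
pose swap t j := swap_regret m (fun i => played tr t i j)
  (fun i => utility G tr t i j).
have swap_bounds t j : (1 <= t <= T)%N ->
    0 <= swap t j <= 2 * alpha * m%:R + regret t j.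
  move=> tT; apply: (swap_regret_bounds (o := fun a => hindsight_opt m G tie tr t a)).
  - by move=> i /andP[_ im]; apply: X_stat.
  - by move=> a; apply: hindsight_argmax.
  - exact: ltW.
  - move=> i a /andP[_ im]; apply: expected_utility_entry; first exact: NG.
    by move=> l; have [] := X_stat t i l tT im.
have game_regret t : (1 <= t <= T)%N -> \sum_(j < n) regret t j <=
    eta^-1 * \sum_(j < n) \sum_(a < d j)
      bregman (@log_barrier R (d j)) (opt t j a) (minimizer tr t 0 a).
  move=> tT.
  apply: (self_play_regret_le (G := G t) (X := played tr t)
    (M := fun i j a => minimizer tr t i a)
    (H := fun i j a => minimizer_hat tr t i a) eta0 eta_le (NG t tT)).
  - by move=> i j; apply: X_stat.
  - by move=> j a; apply: hat0.
  - by move=> j a; apply: M0_interior.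
  - by move=> i j a im; apply: M_step.
  - by move=> i j a im; apply: H_step.
  - by move=> j a; apply: opt_interior.
have swap_sum t : (1 <= t <= T)%N -> swap t k <= 2 * alpha * m%:R * n%:R +
    eta^-1 * \sum_(j < n) \sum_(a < d j)
      bregman (@log_barrier R (d j)) (opt t j a) (minimizer tr t 0 a).
  move=> tT; apply: (@le_trans _ _ (\sum_(j < n) swap t j)).
    rewrite (bigD1 k)//= lerDl; apply: sumr_ge0 => j _.
    by have /andP[] := swap_bounds t j tT.
  apply: (@le_trans _ _ (\sum_(j < n) (2 * alpha * m%:R + regret t j))).
    by apply: ler_sum => j _; have /andP[] := swap_bounds t j tT.
  rewrite big_split/= sumr_const card_ord -(mulr_natr (2 * alpha * m%:R)).
  by rewrite lerD2l game_regret.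
have TN0 : T%:R != 0 :> R by rewrite pnatr_eq0 -lt0n.
have Ti0 : 0 <= T%:R^-1 :> R by rewrite invr_ge0.
have etaN0 : eta != 0 by rewrite gt_eqF.
have ei0 : 0 <= eta^-1 by rewrite invr_ge0 ltW.
have ln0 : 0 <= 1 + ln T%:R :> R by rewrite addr_ge0// ln_ge0// ler1n.
have K0 : 0 <= K by rewrite -alpha_m mulr_ge0// ltW.
have init_regret j (a : 'I_(d j)) : T%:R^-1 * \sum_(1 <= t < T.+1)
    bregman (@log_barrier R (d j)) (opt t j a) (minimizer tr t 0 a) <=
    task_similarity_sq m T G alpha tie tr a +
    8 * K * (d j)%:R ^+ 2 * (1 + ln T%:R).
  have ftl := @follow_the_leader_log_barrier R (d j) (alpha / (d j)%:R)
    (fun t => opt t j a) (fun t => minimizer tr t 0 a) T T0 (c_gt0 j).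
  have {}ftl := ftl (fun t _ => opt_simplex t j a) (fun t b _ => opt_ge t j a b).
  rewrite /= first_game in ftl.
  have {}ftl := ftl (uniform_simplex R (d_gt0 j)) (unif_ge j)
    (fun t => M0_mean t j a).
  apply: (le_trans (ler_wpM2l Ti0 ftl)); rewrite mulrDr lerD2l.
  (* The lower bound [alpha / d j] on coordinates yields the constant 2, which is then relaxed to
     the 8 of the statement. *)
  have -> : T%:R^-1 * (2 * (alpha / (d j)%:R) ^- 2 * (1 + ln T%:R)) =
      2 * K * (d j)%:R ^+ 2 * (1 + ln T%:R).
    rewrite -alpha_T; field.
    by rewrite TN0 gt_eqF// pnatr_eq0 -lt0n d_gt0.
  by rewrite ler_wpM2r// ler_wpM2r ?exprn_ge0// ler_wpM2r//; lra.
have avg : average_swap_regret m T G tr k <= 2 * K * n%:R +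
    eta^-1 * \sum_(j < n) \sum_(a < d j) T%:R^-1 * \sum_(1 <= t < T.+1)
      bregman (@log_barrier R (d j)) (opt t j a) (minimizer tr t 0 a).
  rewrite /average_swap_regret.
  have /(ler_wpM2l Ti0)/le_trans := @ler_sum_nat _ 1 T.+1 _ _ swap_sum; apply.
  rewrite big_split/= sumr_const_nat subn1/= -(mulr_natr (2 * alpha * m%:R * n%:R)).
  rewrite mulrDr -mulr_sumr exchange_big/= -alpha_m.
  have -> : T%:R^-1 * (2 * alpha * m%:R * n%:R * T%:R) = 2 * (alpha * m%:R) * n%:R.
    by field.
  rewrite lerD2l mulrCA ler_wpM2l// mulr_sumr; apply: ler_sum => j _.
  by rewrite exchange_big/= mulr_sumr.
apply: (le_trans avg).
have : \sum_(j < n) \sum_(a < d j) T%:R^-1 * \sum_(1 <= t < T.+1)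
      bregman (@log_barrier R (d j)) (opt t j a) (minimizer tr t 0 a) <=
    \sum_(j < n) (\sum_(a < d j) task_similarity_sq m T G alpha tie tr a +
      K * (8 * (d j)%:R ^+ 3 * (1 + ln T%:R))).
  apply: ler_sum => j _.
  (* The cube arises from [d j] minimizers, each with an excess quadratic in [d j]. *)
  have -> : K * (8 * (d j)%:R ^+ 3 * (1 + ln T%:R)) =
      \sum_(a < d j) 8 * K * (d j)%:R ^+ 2 * (1 + ln T%:R).
    rewrite sumr_const card_ord -(mulr_natr (8 * K * _ * _)); ring.
  by rewrite -big_split/=; apply: ler_sum => a _; apply: init_regret.
move=> /(ler_wpM2l ei0); rewrite big_split/= -mulr_sumr mulrDr.
rewrite mulrDr -mulr_suml => h.
have -> : K * (2 * n%:R) = 2 * K * n%:R by ring.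
rewrite addrCA lerD2l (le_trans h)// lerD2l le_eqVlt; apply/orP; left; apply/eqP.
by rewrite -!mulr_suml; ring.
Qed.
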